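(* Let $\lambda$ be a Dyck path of length $2n$. Then $$\sum_{D\in\mathcal{D}(\lambda/\ast)}q^{\mathrm{art}(D)}=P_{\lambda,\lambda_0},$$ where $\lambda_0=U^{2n}$ and $P_{\lambda,\lambda_0}=\sum_{\nu}q^{\sigma(\nu)}$, the sum running over all labellings $\nu$ of Lascoux--Sch\''utzenberger type of the tree $A(\lambda)$ with capacities, and $\sigma(\nu)$ denoting the sum of the labels of $\nu$.
   Context: Paths: a path of length $L$ is a word in $\{U,D\}$ of length $L$, identified with the lattice path from $(0,0)$ with steps $U=(1,1)$, $D=(1,-1)$; $\lambda(x)$ denotes its height at abscissa $x$. A Dyck path of length $2n$ is such a path of length $2n$ ending at height $0$ and never going below height $0$. Boxes: for integers $a,b$ with $a+b$ odd, the box centered at $(a,b)$ is the closed square with vertices $(a\pm1,b),(a,b\pm1)$. The Young diagram $Y(\lambda)$ of a Dyck path $\lambda$ of length $2n$ is the set of boxes centered at $(a,b)$ with $b-1\ge\lambda(a)$, $b+1\le a$ and $b+1\le 2n-a$. For Dyck paths $\lambda,\mu$ of length $2n$ with $\mu$ weakly above $\lambda$, the skew shape is $\lambda/\mu=Y(\lambda)\setminus Y(\mu)$. A Dyck tile is a nonempty set of boxes whose centers can be listed left to right as $c_0,\dots,c_{2k}$ with $c_{i+1}-c_i\in\{(1,1),(1,-1)\}$, no center lower than $c_0$, and $c_{2k}$ at the same height as $c_0$. A Dyck tiling of $\lambda/\mu$ is a partition of $\lambda/\mu$ into Dyck tiles; it is cover-inclusive if for every tile $\tau$ the translate $\tau-(0,2)$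 either lies entirely below $\lambda$ (every translated box has its top vertex at or below the path $\lambda$) or is contained in a single tile of the tiling. For a tiling $D$: $\mathrm{area}(D)$ is the number of boxes, $\mathrm{tiles}(D)$ the number of tiles, $\mathrm{art}(D)=(\mathrm{area}(D)+\mathrm{tiles}(D))/2$. $\mathcal{D}(\lambda/\ast)$ is the set of all cover-inclusive Dyck tilings of $\lambda/\mu$ over all Dyck paths $\mu$ weakly above $\lambda$. Tree: in a Dyck word match each $U$ with the $D$ that closes it (parenthesis matching); each matched pair is a chord. $A(\lambda)$ is the rooted plane tree with one edge per chord: the edge of chord $c$ hangs directly below the edge of the innermost chord strictly containing $c$, or from the root if no chord contains $c$; siblings are ordered left to right as in $\lambda$. Leaf edges are the chords whose $U$ is immediately followed by its $D$. The capacity of a leaf edge (with respect to $\lambda_0=U^{2n}$) is the number of $D$ steps of $\lambda$ strictly to the left of that $U$. A labelling of Lascoux--Sch\''utzenberger type is an assignment of non-negative integers to the edges of $A(\lambda)$ such that the label of each edge is $\le$ the label of every edge directly below it (labels are non-increasing from leaves to root), and the label of each leaf edge is at most its capacity. *)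

(* Defs.v *)
From HB Require Import structures.
From mathcomp Require Import all_boot all_order all_algebra.
Import Order.TTheory GRing.Theory Num.Theory.

(* Paths: seq bool, true = U = (1,1), false = D = (1,-1). *)

Definition height (l : seq bool) (x : nat) : int :=
  (\sum_(s <- take x l) (if s then 1 else -1))%R.

Definition is_dyck (l : seq bool) : bool :=
  [forall x : 'I_(size l).+1, (0 <= height l x)%R] && (height l (size l) == 0%R).

(* Boxes: a box with center (a,b) is encoded as the pair (a,b) of naturals.
   All boxes of any Young diagram Y(lambda) of a Dyck path of length 2n
   have 0 <= a,b <= 2n, so the finite type below contains them all. *)
Definition box (n : nat) := ('I_(2 * n).+1 * 'I_(2 * n).+1)%type.

Definition inY (n : nat) (l : seq bool) (x : box n) : bool :=
  let a := (x.1 : nat) in let b := (x.2 : nat) in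
  [&& odd (a + b), (height l a <= b%:Z - 1)%R, b.+1 <= a & b.+1 <= 2 * n - a].

Definition skew (n : nat) (l m : seq bool) : {set box n} :=
  [set x | inY n l x & ~~ inY n m x].

Definition weakly_above (n : nat) (l m : seq bool) : bool :=
  [forall x : 'I_(2 * n).+1, (height l x <= height m x)%R].

Definition tile_step (n : nat) (c d : box n) : bool :=
  ((d.1 : nat) == c.1.+1) && (((d.2 : nat) == c.2.+1) || ((c.2 : nat) == d.2.+1)).

Definition dyck_tile_seq (n : nat) (s : seq (box n)) : bool :=
  if s is c0 :: r then
    [&& odd (size s), path (tile_step n) c0 r,
        all (fun c : box n => (c0.2 : nat) <= c.2) s & ((last c0 r).2 == c0.2)]
  else false.

(* A set of boxes is a Dyck tile iff it is the set of centers of such a list.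
   (A Dyck tile has at most 2n+1 boxes since abscissae strictly increase,
   so the bounded length is no restriction.) *)
Definition dyck_tile (n : nat) (t : {set box n}) : bool :=
  [exists m : 'I_(2 * n).+2, exists s : m.-tuple (box n),
     (t == [set x in s]) && dyck_tile_seq n s].

(* tau - (0,2) lies entirely below lambda: every translated box (a,b-2) has
   its top vertex (a,b-1) at or below lambda *)
Definition shift_below (n : nat) (l : seq bool) (t : {set box n}) : bool :=
  [forall x in t, ((x.2 : nat)%:Z - 1 <= height l x.1)%R].

Definition shift_in (n : nat) (t t' : {set box n}) : bool :=
  [forall x in t, exists y in t', ((y.1 : nat) == x.1) && ((y.2 : nat) + 2 == x.2)].

Definition cover_inclusive (n : nat) (l : seq bool) (D : {set {set box n}}) : bool :=
  [forall t in D, shift_below n l t || [exists t' in D, shift_in n t t']].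

Definition ci_dyck_tiling (n : nat) (l m : seq bool) (D : {set {set box n}}) : bool :=
  [&& partition D (skew n l m), [forall t in D, dyck_tile n t] & cover_inclusive n l D].

Definition area (n : nat) (D : {set {set box n}}) : nat := #|cover D|.
Definition tiles (n : nat) (D : {set {set box n}}) : nat := #|D|.
Definition art (n : nat) (D : {set {set box n}}) : nat := (area n D + tiles n D) %/ 2.

Definition matchUD (l : seq bool) (i j : nat) : bool :=
  [&& nth false l i, ~~ nth false l j, i < j, height l j.+1 == height l i &
      [forall x : 'I_(size l).+1, (i < x <= j) ==> (height l i < height l x)%R]].

(* chords are identified with the position of their U step *)
Definition chord (l : seq bool) (i : nat) : bool :=
  [exists j : 'I_(size l), matchUD l i j].

Definition contains (l : seq bool) (c c' : nat) : bool :=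
  [exists j : 'I_(size l), exists j' : 'I_(size l),
     [&& matchUD l c j, matchUD l c' j', c < c' & j' < j]].

(* p is the innermost chord strictly containing c, i.e. the edge of c hangs
   directly below the edge of p in A(lambda) *)
Definition parent (l : seq bool) (p c : nat) : bool :=
  contains l p c &&
  [forall k : 'I_(size l), contains l k c ==> (k == p :> nat) || contains l k p].

Definition leaf (l : seq bool) (i : nat) : bool := matchUD l i i.+1.

(* capacity w.r.t. lambda_0 = U^{2n}: number of D steps strictly left of the U *)
Definition capacity (l : seq bool) (i : nat) : nat := count negb (take i l).

(* Labellings of the edges of A(lambda) are encoded as functions on positions
   'I_(2n) vanishing outside chord positions; labels lie in 'I_n.+1, which is
   no restriction since every label is bounded by a leaf capacity <= n. *)
Definition LS_labelling (n : nat) (l : seq bool) (nu : {ffun 'I_(2 * n) -> 'I_n.+1}) : bool :=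
  [&& [forall i : 'I_(2 * n), ~~ chord l i ==> ((nu i : nat) == 0)],
      [forall i : 'I_(2 * n), forall j : 'I_(2 * n), parent l i j ==> (nu i <= nu j)] &
      [forall i : 'I_(2 * n), leaf l i ==> (nu i <= capacity l i)]].

Definition sigma (n : nat) (l : seq bool) (nu : {ffun 'I_(2 * n) -> 'I_n.+1}) : nat :=
  \sum_(i : 'I_(2 * n) | chord l i) (nu i : nat).

Local Open Scope ring_scope.

Definition P_LS (n : nat) (l : seq bool) : {poly int} :=
  \sum_(nu : {ffun 'I_(2 * n) -> 'I_n.+1} | LS_labelling n l nu) 'X^(sigma n l nu).

Definition tiling_gf (n : nat) (l : seq bool) : {poly int} :=
  \sum_(m : (2 * n).-tuple bool | is_dyck m && weakly_above n l m)
    \sum_(D : {set {set box n}} | ci_dyck_tiling n l m D) 'X^(art n D).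

(* Main.v *)
Require Import Defs.
From mathcomp Require Import all_boot all_order all_algebra.
From mathcomp Require Import zify.
Import Order.TTheory GRing.Theory Num.Theory.

(* Both sides satisfy the recursion F(l) = sum_s q^(capacity of s) F(l minus s)
   over the peaks UD of l, where s is the position of the U of the peak.

   Labellings: the capacity bound at the leaves extends to every chord, since
   capacities are constant along a run of U steps while labels do not decrease.
   The last chord whose label equals its capacity is then a leaf. Deleting it
   lowers the capacities to its right by one, and there all labels are strictly
   below their capacities.

   Tilings (the "spread" of Kim, Meszaros, Panova and Wilson): inserting UD at
   abscissa s into the lower path, the upper path and every tile crossing s, and
   then laying single boxes on the D steps of the upper path m to the left of s,
   turns a tiling of l/m into one whose upper path is U m_left D m_right. The art
   grows by the capacity. The inverse reads s off the first D step of the upper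
   path whose starting vertex does not lie on a one-box tile: by
   cover-inclusiveness all tiles of that column have a peak there, and so has
   the lower path. *)

Set Implicit Arguments.
Unset Strict Implicit.
Unset Printing Implicit Defensive.

(** * Heights of Dyck paths; inserting and deleting peaks *)

Definition ht (l : seq bool) (x : nat) : nat :=
  count id (take x l) - capacity l x.

Lemma heightE l x :
  height l x = ((count id (take x l))%:Z - (capacity l x)%:Z)%R.
Proof.
rewrite /height /capacity; elim: (take x l) => [|s r IHr].
  by rewrite big_nil.
by rewrite big_cons IHr; case: s => /=; lia.
Qed.

Lemma count_takeS (p : pred bool) l x : x < size l ->
  count p (take x.+1 l) = count p (take x l) + p (nth false l x).
Proof. by move=> xl; rewrite (take_nth false) // -cats1 count_cat /= addn0. Qed.

Lemma is_dyckP l :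
  is_dyck l <->
  (forall x, capacity l x <= count id (take x l)) /\
  count id (take (size l) l) = capacity l (size l).
Proof.
rewrite /is_dyck; split.
  case/andP=> /forallP H1 /eqP H2; split; last by move: H2; rewrite heightE; lia.
  move=> x; have [xl|xl] := leqP x (size l).
    by have := H1 (Ordinal (xl : x < (size l).+1)); rewrite heightE /=; lia.
  by have := H1 ord_max; rewrite heightE /= /capacity !take_oversize //; lia.
move=> [H1 H2]; apply/andP; split; last by rewrite heightE H2; lia.
by apply/forallP => x; have := H1 x; rewrite heightE; lia.
Qed.

Lemma height_ht l x : is_dyck l -> height l x = Posz (ht l x).
Proof. by case/is_dyckP => H _; rewrite heightE /ht; have := H x; lia. Qed.

Lemma ht0 l : ht l 0 = 0.
Proof. by rewrite /ht take0. Qed.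

Lemma ht_oversize l x : is_dyck l -> size l <= x -> ht l x = 0.
Proof.
case/is_dyckP => _ H xl; move: H.
by rewrite /ht /capacity take_size take_oversize // => ->; rewrite subnn.
Qed.

Lemma htS l x : is_dyck l -> x < size l ->
  if nth false l x then ht l x.+1 = (ht l x).+1 else ht l x = (ht l x.+1).+1.
Proof.
case/is_dyckP => H _ xl; have := H x; have := H x.+1.
by rewrite /ht /capacity !count_takeS //; case: (nth _ _ _) => /=; lia.
Qed.

Lemma ht_capacity l x : is_dyck l -> x <= size l -> ht l x + 2 * capacity l x = x.
Proof.
move=> dl xl; case/is_dyckP: (dl) => /(_ x) H _.
have := count_predC id (take x l); rewrite size_take_min.
rewrite (minn_idPl xl) /ht /capacity in H *.
by rewrite (eq_count (a1 := predC id) (a2 := negb)) //; lia.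
Qed.

Lemma ht_le l x y : is_dyck l -> x <= y -> ht l x <= ht l y + (y - x).
Proof.
move=> dl xy; elim: y xy => [|y IHy] xy; first by (have -> : x = 0 by lia); rewrite leq_addr.
move: xy; rewrite leq_eqVlt => /orP [/eqP ->|xy]; first by lia.
have {}IHy := IHy xy; have [yl|yl] := ltnP y (size l); last first.
  by have := ht_oversize dl yl; lia.
by have := htS dl yl; case: ifP => _; lia.
Qed.

Lemma ht_le_size l x : is_dyck l -> ht l x <= size l - x.
Proof.
move=> dl; have [xl|xl] := leqP x (size l); last by rewrite ht_oversize //; lia.
by have := ht_le dl xl; rewrite (ht_oversize dl (leqnn _)).
Qed.

Lemma ht_le_abscissa l x : is_dyck l -> ht l x <= x.
Proof.
move=> dl; have [xl|xl] := leqP x (size l); last by rewrite ht_oversize //; lia.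
by have := ht_capacity dl xl; lia.
Qed.

Lemma odd_ht l x : is_dyck l -> x <= size l -> odd (ht l x) = odd x.
Proof.
move=> dl xl; have := congr1 odd (ht_capacity dl xl).
by rewrite oddD mul2n odd_double addbF.
Qed.

Lemma dyck_ht l (f : nat -> nat) :
  f 0 = 0 -> f (size l) = 0 ->
  (forall x, x < size l ->
     if nth false l x then f x.+1 = (f x).+1 else f x = (f x.+1).+1) ->
  is_dyck l /\ forall x, x <= size l -> ht l x = f x.
Proof.
move=> f0 fl fS.
have H x : x <= size l -> count id (take x l) = capacity l x + f x.
  elim: x => [|x IHx] xl; first by rewrite /capacity take0 f0.
  rewrite /capacity !count_takeS // (IHx (ltnW xl)) /capacity.
  by have := fS _ xl; case: (nth _ _ _) => /=; lia.
split; last by move=> x xl; rewrite /ht H //; lia.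
apply/is_dyckP; split; last by rewrite H // fl addn0.
move=> x; have [xl|xl] := leqP x (size l); first by rewrite H //; lia.
by have := H _ (leqnn _); rewrite /capacity take_size take_oversize ?(ltnW xl) //; lia.
Qed.

Definition ins (s : nat) (l : seq bool) := take s l ++ true :: false :: drop s l.
Definition del (s : nat) (l : seq bool) := take s l ++ drop s.+2 l.
Definition peak (l : seq bool) (s : nat) := nth false l s && ~~ nth true l s.+1.
Definition upins (s : nat) (m : seq bool) := true :: take s m ++ false :: drop s m.
Definition updel (s : nat) (m : seq bool) := take s (behead m) ++ drop s.+2 m.

Lemma peak_size l s : peak l s -> s.+1 < size l.
Proof. by case/andP => _; apply: contraR; rewrite -leqNgt => ?; rewrite nth_default. Qed.

Lemma peakE l s : s.+1 < size l -> peak l s = nth false l s && ~~ nth false l s.+1.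
Proof. by move=> sl; rewrite /peak (set_nth_default false true). Qed.

Lemma delK l s : peak l s -> ins s (del s l) = l.
Proof.
move=> ps; have sl := peak_size ps; move: ps; rewrite peakE // => /andP [p1 p2].
have sz : size (take s l) = s by rewrite size_takel //; lia.
rewrite /ins /del take_size_cat // drop_size_cat //.
rewrite -[RHS](cat_take_drop s) (@drop_nth _ false s l) 1?ltnW //.
by rewrite (@drop_nth _ false s.+1 l) // p1 (negbTE p2).
Qed.

Lemma size_ins s l : size (ins s l) = (size l).+2.
Proof. by rewrite /ins size_cat /= !addnS -size_cat cat_take_drop. Qed.

Lemma size_del s l : s.+1 < size l -> size (del s l) = (size l).-2.
Proof. by move=> sl; rewrite size_cat size_takel ?size_drop; lia. Qed.

Lemma size_upins s m : size (upins s m) = (size m).+2.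
Proof. by rewrite /upins /= size_cat /= !addnS -size_cat cat_take_drop. Qed.

Lemma size_updel s m : s.+1 < size m -> size (updel s m) = (size m).-2.
Proof. by move=> sl; rewrite size_cat size_takel ?size_behead ?size_drop; lia. Qed.

Lemma upinsK s m : s <= size m -> updel s (upins s m) = m.
Proof.
move=> sm; rewrite /updel /upins /= take_size_cat ?size_takel //.
by rewrite -cat_rcons drop_size_cat ?cat_take_drop // size_rcons size_takel.
Qed.

Lemma updelK s m : s.+1 < size m -> nth false m 0 -> ~~ nth false m s.+1 ->
  upins s (updel s m) = m.
Proof.
case: m => [|b m] //= sm hb hs; rewrite /upins /updel /= hb.
rewrite take_size_cat ?drop_size_cat ?size_takel //; try lia.
congr (_ :: _); rewrite -[RHS](cat_take_drop s); congr (_ ++ _).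
by rewrite (drop_nth false (n := s)) ?(negbTE hs).
Qed.

Lemma nth_ins s l x : s <= size l ->
  nth false (ins s l) x =
  if x < s then nth false l x else if x == s then true
  else if x == s.+1 then false else nth false l (x - 2).
Proof.
move=> sl; rewrite /ins nth_cat size_takel //; case: ltnP => xs.
  by rewrite nth_take.
case: eqP => [->|xs']; first by rewrite subnn.
case: eqP => [->|xs'']; first by rewrite subSn // subnn.
have -> : x - s = (x - s - 2).+2 by lia.
by rewrite /= nth_drop; congr nth; lia.
Qed.

Lemma nth_upins s m x : s <= size m ->
  nth false (upins s m) x =
  if x == 0 then true else if x <= s then nth false m x.-1
  else if x == s.+1 then false else nth false m (x - 2).
Proof.
move=> sl; rewrite /upins; case: x => [|x] //=; rewrite nth_cat size_takel //.
case: ltnP => xs; first by rewrite nth_take.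
rewrite eqSS; case: eqP => [->|xs']; first by rewrite subnn.
have -> : x - s = (x - s - 1).+1 by lia.
by rewrite /= nth_drop; congr nth; lia.
Qed.

Definition ins_ht (s : nat) (h : nat -> nat) (x : nat) :=
  if x <= s then h x else if x == s.+1 then (h s).+1 else h (x - 2).

Lemma ins_dyck s l : is_dyck l -> s <= size l ->
  is_dyck (ins s l) /\ forall x, ht (ins s l) x = ins_ht s (ht l) x.
Proof.
move=> dl sl; have [||x xl|di H] := @dyck_ht (ins s l) (ins_ht s (ht l)).
- by rewrite /ins_ht /= ht0.
- by rewrite /ins_ht size_ins !ifF ?ht_oversize //; lia.
- rewrite nth_ins // /ins_ht; rewrite size_ins in xl.
  case: (ltngtP x s) => [xs|xs|->].
  + by apply: htS dl _; lia.
  + case: (x =P s.+1) => [->|ne].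
      by rewrite ifF ?subSS ?subn0 //; lia.
    have -> : (x.+1 == s.+1) = false by lia.
    have := @htS l (x - 2) dl; have -> : x.+1 - 2 = (x - 2).+1 by lia.
    by apply; lia.
  + by rewrite eqxx.
split => // x; have [xl|xl] := leqP x (size (ins s l)); first exact: H.
rewrite ht_oversize ?(ltnW xl) // /ins_ht; rewrite size_ins in xl.
by rewrite !ifF ?ht_oversize //; lia.
Qed.

Lemma del_dyck s l : is_dyck l -> peak l s -> is_dyck (del s l).
Proof.
move=> dl pl; have sl := peak_size pl; move: (pl); rewrite peakE // => /andP [p1 p2].
pose f x := if x <= s then ht l x else ht l x.+2.
have Es : ht l s = ht l s.+2.
  have := @htS l s dl; have := @htS l s.+1 dl; rewrite p1 (negbTE p2); lia.
have szd := size_del sl.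
apply: (@dyck_ht _ f _ _ _).1 => [||x].
- by rewrite /f ht0.
- rewrite szd /f; case: ifP => [h|_]; last by rewrite ht_oversize //; lia.
  have -> : (size l).-2 = s by lia.
  by rewrite Es ht_oversize //; lia.
- rewrite szd => xl; have -> : nth false (del s l) x =
    if x < s then nth false l x else nth false l x.+2.
    rewrite /del nth_cat size_takel; last by lia.
    case: ltnP => xs; first by rewrite nth_take.
    by rewrite nth_drop; congr nth; lia.
  rewrite /f; case: (ltngtP x s) => [xs|xs|xs].
  + by apply: htS dl _; lia.
  + by apply: htS dl _; lia.
  + by rewrite xs Es; apply: htS dl _; lia.
Qed.

Definition upins_ht (s : nat) (h : nat -> nat) (x : nat) :=
  if x == 0 then 0 else if x <= s.+1 then (h x.-1).+1 else h (x - 2).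

Lemma upins_dyck s m : is_dyck m -> s <= size m ->
  is_dyck (upins s m) /\ forall x, ht (upins s m) x = upins_ht s (ht m) x.
Proof.
move=> dl sl; have [||x xl|di H] := @dyck_ht (upins s m) (upins_ht s (ht m)).
- by [].
- by rewrite /upins_ht size_upins !ifF ?ht_oversize //; lia.
- rewrite nth_upins // /upins_ht; rewrite size_upins in xl.
  case: x xl => [|x] xl; first by rewrite /= ht0.
  rewrite !(eqSS, ltnS, succnK) /=; case: (ltngtP x s) => [xs|xs|->].
  + have := @htS m x dl; have -> : x < size m by lia.
 by case: (nth _ _ _) => /(_ isT) ->.
  + have := @htS m (x - 1) dl; have -> : x.+2 - 2 = (x - 1).+1 by lia.
    have -> : x.+1 - 2 = x - 1 by lia.
    by apply; lia.
  + by rewrite !subSS subn0.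
split => // x; have [xl|xl] := leqP x (size (upins s m)); first exact: H.
rewrite ht_oversize ?(ltnW xl) // /upins_ht; rewrite size_upins in xl.
by rewrite !ifF ?ht_oversize //; lia.
Qed.

(** * Boxes with natural coordinates *)

Definition bx (n a b : nat) : box n := (inord a, inord b).

Definition boxin (n : nat) (t : {set box n}) (a b : nat) : bool :=
  [&& a <= 2 * n, b <= 2 * n & bx n a b \in t].

Lemma bx_val n (x : box n) : bx n x.1 x.2 = x.
Proof. by case: x => a b; rewrite /bx !inord_val. Qed.

Lemma bx1 n a b : a <= 2 * n -> ((bx n a b).1 : nat) = a.
Proof. by move=> ?; rewrite inordK. Qed.

Lemma bx2 n a b : b <= 2 * n -> ((bx n a b).2 : nat) = b.
Proof. by move=> ?; rewrite inordK. Qed.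

Lemma box_le1 n (x : box n) : x.1 <= 2 * n.
Proof. by rewrite -ltnS. Qed.

Lemma box_le2 n (x : box n) : x.2 <= 2 * n.
Proof. by rewrite -ltnS. Qed.

Lemma box_eq n (x y : box n) : (x.1 : nat) = y.1 -> (x.2 : nat) = y.2 -> x = y.
Proof. by case: x y => [a b] [c d] /= /val_inj -> /val_inj ->. Qed.

Lemma boxin_val n (t : {set box n}) (x : box n) : boxin t x.1 x.2 = (x \in t).
Proof. by rewrite /boxin box_le1 box_le2 bx_val. Qed.

Lemma boxin_ext n (t t' : {set box n}) :
  (forall a b, boxin t a b = boxin t' a b) -> t = t'.
Proof. by move=> H; apply/setP => x; rewrite -!boxin_val H. Qed.

Lemma boxin_set n (p : nat -> nat -> bool) a b :
  boxin [set y : box n | p y.1 y.2] a b = [&& a <= 2 * n, b <= 2 * n & p a b].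
Proof.
rewrite /boxin; case: leqP => // al; case: leqP => // bl.
by rewrite inE bx1 // bx2.
Qed.

Lemma boxin_set1 n (x : box n) a b :
  boxin [set x] a b = (a == x.1) && (b == x.2).
Proof.
rewrite -[[set x]](_ : [set y : box n | ((y.1 : nat) == x.1) && ((y.2 : nat) == x.2)] = _).
  rewrite (@boxin_set n (fun u v => (u == x.1) && (v == x.2))).
  have := box_le1 x; have := box_le2 x.
  by case: eqP => [->|]; case: eqP => [->|]; rewrite ?andbF // => -> ->.
apply/setP => y; rewrite !inE; apply/andP/eqP => [[/eqP e1 /eqP e2]|->] //.
exact: box_eq.
Qed.

(* A Dyck tile is the graph of a height function over an interval of abscissae. *)
Definition dyck_graph (P : nat -> nat -> bool) : Prop :=
  exists i j h, [/\ i <= j, forall a b, P a b = [&& i <= a, a <= j & b == h a],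
    forall a, i <= a < j -> h a.+1 = (h a).+1 \/ h a = (h a.+1).+1,
    forall a, i <= a <= j -> h i <= h a & h j = h i].

Lemma dyck_graph_odd i j (h : nat -> nat) : i <= j ->
  (forall a, i <= a < j -> h a.+1 = (h a).+1 \/ h a = (h a.+1).+1) ->
  odd (h j + j) = odd (h i + i).
Proof.
elim: j => [|j IHj] ij hS; first by have -> : i = 0 by lia.
move: ij; rewrite leq_eqVlt => /orP [/eqP ->//|ij].
by rewrite -IHj //; [have [] := hS j _; lia | move=> a aj; apply: hS; lia].
Qed.

Lemma dyck_tile_seq_graph n (s : seq (box n)) :
  dyck_tile_seq n s -> dyck_graph (boxin [set x in s]).
Proof.
case: s => [|c0 r] //= /and4P [os pr /andP [_ ar] /eqP lr].
pose s := c0 :: r.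
have col k : k < size s -> ((nth c0 s k).1 : nat) = c0.1 + k.
  elim: k => [|k IHk] sk; first by rewrite addn0.
  have := pathP c0 pr k sk; rewrite /tile_step => /andP [/eqP e _].
  by rewrite /s /= e IHk ?addnS // ltnW.
have ms x : (x \in s) = [&& c0.1 <= x.1, x.1 <= c0.1 + size r &
  (x.2 : nat) == (nth c0 s (x.1 - c0.1)).2].
  apply/idP/and3P.
    case/(nthP c0) => k sk <-; rewrite (col _ sk).
    have -> : c0.1 + k - c0.1 = k by lia.
    by split; rewrite ?leq_addr ?leq_add2l //.
  case=> x1 x2 /eqP x3; have sk : x.1 - c0.1 < size s.
    by rewrite /s /= ltnS leq_subLR.
  have -> : x = nth c0 s (x.1 - c0.1); last exact: mem_nth.
  by apply: box_eq => //; rewrite (col _ sk) subnKC.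
have bnd : c0.1 + size r <= 2 * n.
  by rewrite -(col (size r)) ?box_le1 // /s /=.
exists (c0.1 : nat), (c0.1 + size r), (fun a => ((nth c0 s (a - c0.1)).2 : nat)).
split.
- by rewrite leq_addr.
- move=> a b; rewrite /boxin; case: (leqP a (2 * n)) => al /=; last first.
    by apply/esym/negbTE/negP => /and3P [h1 h2 _]; have := leq_trans h2 bnd; rewrite leqNgt al.
  case: (leqP b (2 * n)) => bl /=; last first.
    apply/esym/negbTE/negP => /and3P [_ _ /eqP e]; move: bl; by rewrite e ltnNge box_le2.
  by rewrite inE -/s ms !bx1 // bx2.
- move=> a /andP [a1 a2]; have sk : a - c0.1 < size r by rewrite ltn_subLR.
  have := pathP c0 pr _ sk; rewrite /tile_step => /andP [_].
  rewrite subSn //.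
  by rewrite /s /= => /orP [] /eqP ->; [left | right].
- move=> a /andP [a1 a2]; rewrite subnn /=.
  have /(mem_nth c0) : a - c0.1 < size s by rewrite /s /= ltnS leq_subLR.
  rewrite {2}/s inE => /orP [/eqP -> //|H].
  by move/allP: ar => /(_ _ H).
- by rewrite subnn addKn; move: lr; rewrite (last_nth c0) => ->.
Qed.

Lemma dyck_tileP n (t : {set box n}) : dyck_tile n t <-> dyck_graph (boxin t).
Proof.
split.
  by case/existsP => m /existsP [s] /andP [/eqP -> /dyck_tile_seq_graph].
move=> [i [j [h [ij Ht hS hmin hE]]]].
have Hin a : i <= a <= j -> boxin t a (h a) by rewrite Ht eqxx andbT.
have Hb a : i <= a <= j -> a <= 2 * n /\ h a <= 2 * n.
  by move=> /Hin /and3P [].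
pose s := [seq bx n a (h a) | a <- iota i (j - i).+1].
have szs : size s = (j - i).+1 by rewrite size_map size_iota.
have jb : j <= 2 * n by case: (Hb j); lia.
have ms : (size s < (2 * n).+2) by rewrite szs; lia.
apply/existsP; exists (Ordinal ms); apply/existsP; exists (in_tuple s) => /=.
have ns k : k <= j - i -> nth (bx n i (h i)) s k = bx n (i + k) (h (i + k)).
  move=> kl; rewrite (nth_map 0) ?size_iota ?nth_iota //.
have sE : s = bx n i (h i) :: behead s by [].
apply/andP; split.
  apply/eqP/setP => x; rewrite inE -boxin_val Ht; apply/idP/idP.
    case/and3P => x1 x2 /eqP x3; apply/mapP; exists (x.1 : nat).
      by rewrite mem_iota x1 addnS ltnS subnKC.
    by rewrite -x3 bx_val.
  case/mapP => a; rewrite mem_iota => ai ->.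
  have [|h1 h2] := Hb a; first by lia.
  by rewrite bx1 // bx2 // eqxx; lia.
change (is_true (dyck_tile_seq n s)); rewrite /dyck_tile_seq sE.
have [|b1 b2] := Hb i; first lia.
have odds : odd (j - i).+1.
  have := @dyck_graph_odd i j h ij hS; rewrite hE !oddD oddS oddB //.
  by case: (odd _); case: (odd j); case: (odd i).
apply/and4P; split.
- by rewrite -sE szs.
- apply/(pathP (bx n i (h i))) => k; rewrite size_behead szs succnK => kl.
  rewrite -sE nth_behead !ns; try lia.
  rewrite /tile_step addnS; have [|c1 c2] := Hb (i + k); first by lia.
  have [|d1 d2] := Hb (i + k).+1; first by lia.
  rewrite !(bx1, bx2) // eqxx /=.
  by case: (hS (i + k)) => [|->|->]; rewrite ?eqxx ?orbT //; lia.
- rewrite -sE; apply/allP => x /mapP [a]; rewrite mem_iota => ai ->.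
  have [|h1 h2] := Hb a; first by lia.
  by rewrite !bx2 //; apply: hmin; lia.
- have := nth_last (bx n i (h i)) s; rewrite szs /= -[last _ _]/(last (bx n i (h i)) s) => <-.
  by rewrite ns // subnKC // hE.
Qed.

(** * Cover-inclusive tilings *)

Definition inskew (l m : seq bool) (a b : nat) : bool :=
  odd (a + b) && (ht l a < b < ht m a).

Lemma boxin_skew n l m a b : is_dyck l -> is_dyck m ->
  size l = 2 * n -> size m = 2 * n -> boxin (Defs.skew n l m) a b = inskew l m a b.
Proof.
move=> dl dm sl sm; rewrite /boxin /inskew.
have := ht_le_size a dm; have := ht_le_abscissa a dm => h1 h2.
case: (leqP a (2 * n)) => al /=; last by case: (odd _) => //=; lia.
case: (leqP b (2 * n)) => bl /=; last by case: (odd _) => //=; lia.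
rewrite inE /inY bx1 // bx2 // !height_ht //.
have := @odd_ht m a dm; rewrite sm => /(_ al) pm.
have pab : odd (a + b) -> b != ht m a.
  by rewrite oddD -pm; apply: contraL => /eqP ->; rewrite addbb.
by case: (odd _) pab => //= /(_ isT) pab; lia.
Qed.

Record valid (n : nat) (l m : seq bool) (D : {set {set box n}}) : Prop := Valid {
  v_dyck : is_dyck m;
  v_size : size m = 2 * n;
  v_above : forall x, ht l x <= ht m x;
  v_tile : forall t, t \in D -> dyck_graph (boxin t);
  v_in : forall t a b, t \in D -> boxin t a b -> inskew l m a b;
  v_cov : forall a b, inskew l m a b -> exists2 t, t \in D & boxin t a b;
  v_dis : forall t t' a b, t \in D -> t' \in D ->
    boxin t a b -> boxin t' a b -> t = t';
  v_ci : forall t, t \in D -> (forall a b, boxin t a b -> b <= (ht l a).+1) \/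
    exists2 t', t' \in D & forall a b, boxin t a b -> 2 <= b /\ boxin t' a (b - 2)
}.

Lemma shift_belowP n l (t : {set box n}) : is_dyck l ->
  shift_below n l t <-> forall a b, boxin t a b -> b <= (ht l a).+1.
Proof.
move=> dl; rewrite /shift_below; split.
  move=> /forall_inP H a b /and3P [al bl /H]; rewrite height_ht //.
  by rewrite bx1 // bx2 //; lia.
move=> H; apply/forall_inP => x xt; rewrite height_ht //.
by have := H x.1 x.2; rewrite boxin_val => /(_ xt); lia.
Qed.

Lemma shift_inP n (t t' : {set box n}) :
  shift_in n t t' <-> forall a b, boxin t a b -> 2 <= b /\ boxin t' a (b - 2).
Proof.
rewrite /shift_in; split.
  move=> /forall_inP H a b /and3P [al bl /H] /exists_inP [y yt].
  rewrite bx1 // bx2 // => /andP [/eqP <- /eqP <-].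
  by rewrite addnK boxin_val; split => //; lia.
move=> H; apply/forall_inP => x xt; apply/exists_inP.
have := H x.1 x.2; rewrite boxin_val => /(_ xt) [x2 /and3P [h1 h2 yt]].
by exists (bx n x.1 (x.2 - 2)); rewrite // bx1 // bx2 // subnK ?eqxx.
Qed.

Lemma validP n l m (D : {set {set box n}}) : is_dyck l -> size l = 2 * n ->
  size m = 2 * n ->
  is_dyck m && weakly_above n l m && ci_dyck_tiling n l m D <-> valid l m D.
Proof.
move=> dl sl sm; split.
  case/andP=> /andP [dm wa] /and3P [/and3P [/eqP cD tD D0] /forall_inP ti /forall_inP ci].
  have cv a b : inskew l m a b = [exists t in D, boxin t a b].
    rewrite -(@boxin_skew n) // -cD; apply/and3P/exists_inP.
      by case=> al bl /bigcupP [t tD' xt]; exists t => //; apply/and3P.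
    by case=> t tD' /and3P [al bl xt]; split => //; apply/bigcupP; exists t.
  split => //.
  - move=> x; have [xl|xl] := leqP (2 * n).+1 x.
      by rewrite !ht_oversize // ?sl ?sm ltnW.
    by have /forallP /(_ (Ordinal xl)) := wa; rewrite !height_ht //=; lia.
  - by move=> t /ti /dyck_tileP.
  - by move=> t a b tD' tab; rewrite cv; apply/exists_inP; exists t.
  - by move=> a b; rewrite cv => /exists_inP.
  - move=> t t' a b t1 t2 /and3P [_ _ h1] /and3P [_ _ h2].
    apply/eqP/negPn/negP => ne.
    have /trivIsetP /(_ _ _ t1 t2 ne) := tD.
    by rewrite disjoint_sym => /disjointFr /(_ h2); rewrite h1.
  - move=> t tD'; case/orP: (ci _ tD') => [/shift_belowP|/exists_inP [t' t1 /shift_inP]].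
      by left; auto.
    by right; exists t'.
case=> dm _ wa ti in_ cov dis ci; apply/andP; split; last (apply/and3P; split).
- rewrite dm; apply/forallP => x; rewrite !height_ht //; have := wa x; by rewrite lez_nat.
- apply/and3P; split.
  + apply/eqP/boxin_ext => a b; rewrite boxin_skew //; apply/idP/idP.
      case/and3P => al bl /bigcupP [t tD xt]; apply: (in_ t) => //.
      exact/and3P.
    case/cov => t tD /and3P [al bl xt]; apply/and3P; split => //.
    by apply/bigcupP; exists t.
  + apply/trivIsetP => t t' t1 t2; apply: contraNT => /pred0Pn [x /andP [x1 x2]].
    by apply/eqP; apply: (dis _ _ x.1 x.2) => //; rewrite boxin_val.
  + apply/negP => /ti [i [j [h [ij H _ _ _]]]].
    by have := H i (h i); rewrite eqxx ij leqnn /boxin inE !andbF.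
- by apply/forall_inP => t /ti /dyck_tileP.
- apply/forall_inP => t /ci [/(shift_belowP _ dl) ->//|[t' t1 /shift_inP h]].
  by apply/orP; right; apply/exists_inP; exists t'.
Qed.

(** * Spreading a tiling at a column *)

(* A box (s, b) is replaced by the peak (s, b), (s+1, b+1), (s+2, b). *)
Definition spread_rel (s : nat) (p : nat -> nat -> bool) (a b : nat) : bool :=
  if a <= s then p a b else if a == s.+1 then (0 < b) && p s b.-1 else p (a - 2) b.

Definition contract_rel (s : nat) (p : nat -> nat -> bool) (a b : nat) : bool :=
  if a <= s then p a b else p a.+2 b.

Definition spread (n s : nat) (t : {set box n}) : {set box n.+1} :=
  [set y : box n.+1 | spread_rel s (boxin t) y.1 y.2].

Definition contract (n s : nat) (t : {set box n.+1}) : {set box n} :=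
  [set y : box n | contract_rel s (boxin t) y.1 y.2].

(* The boxes resting on the D steps of m that end at abscissae 1, ..., s. *)
Definition ribbon_rel (s : nat) (m : seq bool) (a b : nat) : bool :=
  [&& 0 < a, a <= s, ~~ nth false m a.-1 & b == (ht m a).+1].

Definition ribbon (n s : nat) (m : seq bool) : {set {set box n.+1}} :=
  [set [set y] | y : box n.+1 & ribbon_rel s m y.1 y.2].

Lemma boxin_le n (t : {set box n}) a b : boxin t a b -> a <= 2 * n /\ b <= 2 * n.
Proof. by case/and3P. Qed.

Lemma boxin_spread n s (t : {set box n}) a b :
  boxin (spread s t) a b = spread_rel s (boxin t) a b.
Proof.
rewrite boxin_set /spread_rel.
case: ifP => as_; last case: ifP => [/eqP ->|as1].
- by case E: (boxin t a b); rewrite ?andbF //; have := boxin_le E; lia.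
- case E: (boxin t s b.-1); rewrite ?andbF //; have [] := boxin_le E; lia.
- by case E: (boxin t _ b); rewrite ?andbF //; have := boxin_le E; lia.
Qed.

Lemma boxin_contract n s (t : {set box n.+1}) a b :
  boxin (contract s t) a b = [&& a <= 2 * n, b <= 2 * n & contract_rel s (boxin t) a b].
Proof. by rewrite boxin_set. Qed.

Lemma spreadK n s (t : {set box n}) : contract s (spread s t) = t.
Proof.
apply: boxin_ext => a b; rewrite boxin_contract /contract_rel !boxin_spread /spread_rel.
have -> : (if a <= s then if a <= s then boxin t a b else if a == s.+1 then (0 < b) && boxin t s b.-1
   else boxin t (a - 2) b else if a.+2 <= s then boxin t a.+2 b else
   if a.+2 == s.+1 then (0 < b) && boxin t s b.-1 else boxin t (a.+2 - 2) b) = boxin t a b.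
  case: (leqP a s) => // h; rewrite !ifF; try lia.
  by congr boxin; lia.
by case E: (boxin t a b); rewrite ?andbF //; have := boxin_le E; lia.
Qed.

Lemma contractK n s (t : {set box n.+1}) :
  (forall a b, boxin t a b -> b <= 2 * n) ->
  (forall b, boxin t s.+1 b = (0 < b) && boxin t s b.-1) ->
  (forall b, boxin t s.+2 b = boxin t s b) -> s <= 2 * n ->
  spread s (contract s t) = t.
Proof.
move=> tb t1 t2 sn; apply: boxin_ext => a b; rewrite boxin_spread /spread_rel.
rewrite !boxin_contract /contract_rel leqnn.
case: (ltngtP a s.+1) => [as_|as_|->]; last first.
- rewrite ifF; last by lia.
  rewrite t1; case: b => [|b] //=; case E: (boxin t s b); rewrite ?andbF //.
  by have := tb _ _ E; lia.
- rewrite ifF; last by lia.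
  have -> : (if a - 2 <= s then boxin t (a - 2) b else boxin t (a - 2).+2 b) = boxin t a b.
    case: ifP => h; last by congr boxin; lia.
    have -> : a - 2 = s by lia.
    by rewrite -t2; congr boxin; lia.
  by case E: (boxin t a b); rewrite ?andbF //; have := tb _ _ E; have := boxin_le E; lia.
- rewrite !ifT //; case E: (boxin t a b); rewrite ?andbF //.
  by have := tb _ _ E; lia.
Qed.

Lemma ribbonP n s m (t : {set box n.+1}) : t \in ribbon n s m ->
  exists a b, [/\ ribbon_rel s m a b, t = [set bx n.+1 a b], a <= 2 * n.+1,
    b <= 2 * n.+1 & forall u v, boxin t u v = (u == a) && (v == b)].
Proof.
case/imsetP => y; rewrite inE => h ->; exists y.1, y.2; split => //.
- by rewrite bx_val.
- exact: box_le1.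
- exact: box_le2.
- by move=> u v; rewrite boxin_set1.
Qed.

Lemma ribbonI n s m a b : ribbon_rel s m a b -> a <= 2 * n.+1 -> b <= 2 * n.+1 ->
  [set bx n.+1 a b] \in ribbon n s m.
Proof. by move=> h al bl; apply/imsetP; exists (bx n.+1 a b); rewrite // inE bx1 // bx2. Qed.

Lemma boxin_bx n a b u v : a <= 2 * n -> b <= 2 * n ->
  boxin [set bx n a b] u v = (u == a) && (v == b).
Proof. by move=> al bl; rewrite boxin_set1 bx1 // bx2. Qed.

Lemma inskew_spread l m s a b : is_dyck l -> is_dyck m -> size l = size m ->
  s <= size m -> (forall x, ht l x <= ht m x) ->
  inskew (ins s l) (upins s m) a b = spread_rel s (inskew l m) a b || ribbon_rel s m a b.
Proof.
move=> dl dm slm sm wa; rewrite /inskew.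
rewrite !(ins_dyck _ _).2 ?slm // !(upins_dyck _ _).2 //.
rewrite /ins_ht /upins_ht /spread_rel /ribbon_rel.
case: (ltngtP a s.+1) => as_.
- have -> : a <= s by lia.
  case: a as_ => [|a] as_ /=; first by rewrite !ht0; lia.
  have wa1 := wa a.+1; have al : a < size m by lia.
  have := htS dm al; have := ht_capacity dm al.
  by case: (nth _ _ _) => /=; lia.
- by rewrite !(@ifF _ (a <= s)) ?(@ifF _ (a == 0)); lia.
- rewrite as_ ltnn /=.
  by case: b => [|b] /=; lia.
Qed.

Lemma spread_rel_ribbon l m s a b : is_dyck m ->
  spread_rel s (inskew l m) a b -> ribbon_rel s m a b -> False.
Proof.
move=> dm h /and4P [h1 h2 h3 /eqP h4]; move: h; rewrite /spread_rel h2 /inskew; lia.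
Qed.

Lemma spread_dyck_graph s (p q : nat -> nat -> bool) :
  (forall a b, q a b = spread_rel s p a b) -> dyck_graph p -> dyck_graph q.
Proof.
move=> qE [i [j [h [ij Hp hS hmin hE]]]].
pose h' := ins_ht s h.
have [is_|si] := leqP i s; last first.
  exists i.+2, j.+2, h'; split => //.
  - move=> a b; rewrite qE /spread_rel /h' /ins_ht !Hp.
    by case: (ltngtP a s.+1) => as_; repeat (case: ifP => ?); lia.
  - move=> a /andP [a1 a2]; have := hS (a - 2) _; have -> : (a - 2).+1 = a.+1 - 2 by lia.
    by rewrite /h' /ins_ht !ifF; try lia; apply; lia.
  - move=> a /andP [a1 a2]; rewrite /h' /ins_ht !ifF; try lia.
    by rewrite !subSS subn0; apply: hmin; lia.
  - by rewrite /h' /ins_ht !ifF; try lia; rewrite !subSS !subn0.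
have [js|sj] := ltnP j s.
  exists i, j, h'; split => //.
  - move=> a b; rewrite qE /spread_rel /h' /ins_ht !Hp.
    by case: (ltngtP a s.+1) => as_; repeat (case: ifP => ?); lia.
  - move=> a /andP [a1 a2]; rewrite /h' /ins_ht !ifT; try lia.
    by apply: hS; lia.
  - move=> a /andP [a1 a2]; rewrite /h' /ins_ht !ifT; try lia.
    by apply: hmin; lia.
  - by rewrite /h' /ins_ht !ifT //; lia.
exists i, j.+2, h'; split => //.
- by lia.
- move=> a b; rewrite qE /spread_rel /h' /ins_ht !Hp.
  by case: (ltngtP a s.+1) => as_; repeat (case: ifP => ?); lia.
- move=> a /andP [a1 a2]; rewrite /h' /ins_ht.
  case: (ltngtP a s) => as_.
  + by apply: hS; lia.
  + have -> : (a.+1 == s.+1) = false by lia.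
    case: (a =P s.+1) => [->|ne].
      by rewrite !subSS subn0; right.
    have := hS (a - 2) _; have -> : (a - 2).+1 = a.+1 - 2 by lia.
    by apply; lia.
  + by rewrite as_ eqxx; left.
- move=> a /andP [a1 a2]; rewrite /h' /ins_ht is_.
  case: ifP => h1; first by apply: hmin; lia.
  case: ifP => h2; last by apply: hmin; lia.
  by have := hmin s; lia.
- by rewrite /h' /ins_ht is_ !ifF; try lia; rewrite !subSS subn0.
Qed.

Lemma contract_dyck_graph s (p q : nat -> nat -> bool) :
  (forall a b, q a b = contract_rel s p a b) ->
  (forall b, p s.+1 b = (0 < b) && p s b.-1) ->
  (forall b, p s.+2 b = p s b) ->
  dyck_graph p -> dyck_graph q.
Proof.
move=> qE p1 p2 [i [j [h [ij Hp hS hmin hE]]]].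
pose h' a := if a <= s then h a else h a.+2.
have h1 := p1 (h s.+1); have h2 := p1 (h s).+1; have h3 := p2 (h s); have h4 := p2 (h s.+2).
rewrite !Hp /= in h1 h2 h3 h4.
have qE' a b : q a b = if a <= s then [&& i <= a, a <= j & b == h a]
    else [&& i <= a.+2, a.+2 <= j & b == h a.+2].
  by rewrite qE /contract_rel !Hp.
have [js|sj] := leqP j s.
  have {}js : j < s by lia.
  exists i, j, h; split => //.
  by move=> a b; rewrite qE'; case: (leqP a s) => // as_; clear - js as_ ; lia.
have [si|is_] := ltnP s.+1 i.
  have {}si : s.+2 < i by lia.
  exists (i - 2), (j - 2), h'; split.
  - by lia.
  - by move=> a b; rewrite qE' /h'; case: (leqP a s) => // as_; clear - si as_; lia.
  - move=> a /andP [a1 a2]; rewrite /h' !ifF; try lia.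
    by apply: hS; lia.
  - move=> a /andP [a1 a2]; rewrite /h' !ifF; try lia.
    have -> : (i - 2).+2 = i by lia.
    by apply: hmin; lia.
  - rewrite /h' !ifF; try lia.
    have -> : (i - 2).+2 = i by lia.
    by have -> : (j - 2).+2 = j by lia.
have [i1 i2 i3 i4] : [/\ i <= s, s.+2 <= j, h s.+1 = (h s).+1 & h s.+2 = h s].
  by move: h1 h2 h3 h4; rewrite is_ sj !eqxx /=; split; lia.
exists i, (j - 2), h'; split.
- by lia.
- by move=> a b; rewrite qE' /h'; case: (leqP a s) => // as_; clear - is_ sj i1 i2 as_; lia.
- move=> a /andP [a1 a2]; rewrite /h'; case: (ltngtP a s) => as_.
  + by apply: hS; lia.
  + by apply: hS; lia.
  + by rewrite as_ -i4; apply: hS; lia.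
- move=> a /andP [a1 a2]; rewrite /h' i1.
  by case: ifP => _; apply: hmin; lia.
- rewrite /h' i1; case: ifP => js.
    have -> : j - 2 = s by lia.
    by rewrite -i4 -hE; congr h; lia.
  by rewrite -hE; congr h; lia.
Qed.

Lemma dyck_graph1 (p : nat -> nat -> bool) a b :
  (forall u v, p u v = (u == a) && (v == b)) -> dyck_graph p.
Proof.
move=> H; exists a, a, (fun=> b); split=> //.
- by move=> u v; rewrite H eqn_leq -andbA andbCA.
- by move=> u; lia.
Qed.

Definition spread_tiling (n s : nat) (m : seq bool) (D : {set {set box n}}) :
  {set {set box n.+1}} := [set spread s t | t in D] :|: ribbon n s m.

Lemma spread_tilingP n s m (D : {set {set box n}}) t : t \in spread_tiling s m D ->
  (exists2 t0, t0 \in D & t = spread s t0) \/ t \in ribbon n s m.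
Proof. by rewrite inE => /orP [/imsetP|]; [left|right]. Qed.

Lemma spread_valid n s l m (D : {set {set box n}}) :
  is_dyck l -> size l = 2 * n -> s <= 2 * n -> valid l m D ->
  valid (ins s l) (upins s m) (spread_tiling s m D).
Proof.
move=> dl sl sn [dm sm wa ti in_ cov dis ci].
have insk a b : inskew (ins s l) (upins s m) a b =
    spread_rel s (inskew l m) a b || ribbon_rel s m a b.
  by apply: inskew_spread; rewrite ?sl ?sm.
have insp t a b : t \in D -> spread_rel s (boxin t) a b -> spread_rel s (inskew l m) a b.
  move=> tD; rewrite /spread_rel; case: ifP => _; first exact: in_.
  by case: ifP => _; [case/andP => -> | ]; exact: in_.
have sl' : s <= size l by rewrite sl.
have sm' : s <= size m by rewrite sm.
have [dil hl] := ins_dyck dl sl'; have [dum hm] := upins_dyck dm sm'.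
have inD t : t \in D -> spread s t \in spread_tiling s m D.
  by move=> tD; rewrite inE imset_f.
split => //.
- by rewrite size_upins sm; lia.
- move=> x; rewrite hl hm /ins_ht /upins_ht.
  case: (ltngtP x s.+1) => xs.
  + rewrite ifT //; case: x xs => [|x] xs; first by rewrite ht0.
    have xm : x < size m by lia.
    by have := wa x.+1; have := htS dm xm; case: (nth _ _ _) => /=; lia.
  + by rewrite !ifF //; lia.
  + by rewrite xs ltnn /=; have := wa s.
- move=> t /spread_tilingP [[t0 t0D ->]|/ribbonP [a [b [_ _ _ _ tE]]]].
    by apply: spread_dyck_graph (ti _ t0D); exact: boxin_spread.
  exact: dyck_graph1 tE.
- move=> t a b /spread_tilingP [[t0 t0D ->]|/ribbonP [u [v [r _ _ _ tE]]]].
    by rewrite boxin_spread insk => /insp -> //.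
  by rewrite tE insk => /andP [/eqP -> /eqP ->]; rewrite r orbT.
- move=> a b; rewrite insk => /orP [|r]; last first.
    have [h1 h2 h3 /eqP h4] := and4P r; have h5 := ht_le_size a dm.
    have [al bl] : a <= 2 * n.+1 /\ b <= 2 * n.+1 by move: sm; split; lia.
    exists [set bx n.+1 a b]; first by rewrite inE ribbonI ?orbT.
    by rewrite boxin_bx // !eqxx.
  have E t : t \in D -> spread_rel s (boxin t) a b ->
      exists2 t, t \in spread_tiling s m D & boxin t a b.
    by move=> tD h; exists (spread s t); rewrite ?inD ?boxin_spread.
  rewrite {1}/spread_rel; case: ifP => as_.
    by case/cov => t tD tab; apply: (E t) => //; rewrite /spread_rel as_.
  case: ifP => as1.
    case/andP => b0 /cov [t tD tab].
    by apply: (E t) => //; rewrite /spread_rel as_ as1 b0.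
  by case/cov => t tD tab; apply: (E t) => //; rewrite /spread_rel as_ as1.
- move=> t t' a b /spread_tilingP [[t0 t0D ->]|/ribbonP [u [v [r te _ _ tE]]]]
    /spread_tilingP [[t1 t1D ->]|/ribbonP [u' [v' [r' te' _ _ tE']]]].
  + rewrite !boxin_spread => h h'; congr spread; move: h h'; rewrite /spread_rel.
    case: ifP => _; first exact: dis.
    case: ifP => _; last exact: dis.
    by move=> /andP [_ h] /andP [_ h']; exact: dis h h'.
  + rewrite boxin_spread tE' => h /andP [/eqP ea /eqP eb].
    by case: (spread_rel_ribbon dm (insp _ _ _ t0D h)); rewrite ea eb.
  + rewrite boxin_spread tE => /andP [/eqP ea /eqP eb] h.
    by case: (spread_rel_ribbon dm (insp _ _ _ t1D h)); rewrite ea eb.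
  + rewrite tE tE' te te' => /andP [/eqP <- /eqP <-] /andP [/eqP <- /eqP <-] //.
- move=> t /spread_tilingP [[t0 t0D ->]|/ribbonP [u [v [r te _ _ tE]]]].
    case: (ci _ t0D) => [h|[t1 t1D h]].
      left => a b; rewrite boxin_spread /spread_rel hl /ins_ht.
      case: ifP => _; first exact: h.
      by case: ifP => _; [case/andP => b0 /h; lia | exact: h].
    right; exists (spread s t1); first exact: inD.
    move=> a b; rewrite !boxin_spread /spread_rel.
    case: ifP => _; first exact: h.
    case: ifP => _; last exact: h.
    case/andP => b0 /h [b1 h1]; split; first by lia.
    have -> : (b - 2).-1 = b.-1 - 2 by lia.
    by rewrite h1; lia.
  have [u0 us nu /eqP ve] := and4P r; have um : u <= size m by lia.
  have := wa u; rewrite leq_eqVlt => /orP [/eqP e|lt].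
    left => a b; rewrite tE => /andP [/eqP -> /eqP ->].
    by rewrite hl /ins_ht us e ve.
  have [|t0 t0D tt] := cov u (v - 2).
    rewrite /inskew ve; have := ht_capacity dm um.
    have ul : u <= size l by rewrite sl -sm.
    by have := ht_capacity dl ul; lia.
  right; exists (spread s t0); first exact: inD.
  move=> a b; rewrite tE => /andP [/eqP -> /eqP ->].
  by rewrite boxin_spread /spread_rel us; split => //; lia.
Qed.

(** * Contracting a tiling at its first tight column *)

(* The box whose top is the vertex of m at abscissa x; the predecessor is
   harmless, since tight only looks at starting vertices of D steps. *)
Definition top_box (n : nat) (m : seq bool) (x : nat) : {set box n} :=
  [set bx n x (ht m x).-1].

Definition tight (n : nat) (m : seq bool) (D : {set {set box n}}) (x : nat) : bool :=
  ~~ nth false m x && (top_box n m x \notin D).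

Lemma boxin_top n m x u v : is_dyck m -> size m = 2 * n -> x <= 2 * n ->
  boxin (top_box n m x) u v = (u == x) && (v == (ht m x).-1).
Proof.
move=> dm sm xn; rewrite /top_box boxin_bx //.
by have := ht_le_size x dm; rewrite sm; lia.
Qed.

Lemma ribbon_topP n s m (t : {set box n.+1}) : is_dyck m -> size m = 2 * n -> s <= 2 * n ->
  t \in ribbon n s m <->
  exists2 x, x <= s & ~~ nth false (upins s m) x /\ t = top_box n.+1 (upins s m) x.
Proof.
move=> dm sm sn; have sm' : s <= size m by rewrite sm.
have [dum hm] := upins_dyck dm sm'.
have E x : 0 < x -> x <= s -> ~~ nth false m x.-1 -> (ht m x).+1 = (ht (upins s m) x).-1.
  case: x => // x _ xs nx; rewrite hm /upins_ht ifT ?leqW //=.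
  have xm : x < size m by lia.
  by have := htS dm xm; rewrite /= in nx; rewrite (negbTE nx).
split.
  case/ribbonP => a [b [/and4P [a0 as_ na /eqP bE] -> al bl _]].
  exists a => //; rewrite nth_upins // as_ /top_box -E // bE.
  by rewrite ifF //; lia.
case=> x xs [nx ->]; move: nx; rewrite nth_upins // xs.
case: eqP => // /eqP x0 nx; have xp : 0 < x by lia.
rewrite /top_box -E //; have := ht_le_size x dm; rewrite sm => h.
by apply: ribbonI; rewrite /ribbon_rel ?eqxx ?xp ?xs ?nx //; lia.
Qed.

Section Special.

Variables (n s : nat) (l m : seq bool) (D : {set {set box n}}).
Hypotheses (dl : is_dyck l) (sl : size l = 2 * n) (vD : valid l m D).
Hypotheses (sn : s.+1 < 2 * n) (ts : tight m D s.+1).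
Hypothesis nts : forall x, x <= s -> ~~ tight m D x.

Let dm := v_dyck vD.
Let sm := v_size vD.

Lemma top_skew x : x <= s -> ~~ nth false m x -> top_box n m x \in D /\ ht l x < (ht m x).-1.
Proof.
move=> xs nx; have := nts xs; rewrite /tight nx /= negbK => tD; split => //.
have := v_in vD tD; move/(_ x (ht m x).-1); rewrite boxin_top // ?eqxx; last by lia.
by move/(_ isT); case/and3P.
Qed.

Lemma special_down : ht m s.+1 = (ht m s.+2).+1.
Proof.
have [ns _] := andP ts; have xm : s.+1 < size m by rewrite sm.
by have := htS dm xm; rewrite (negbTE ns).
Qed.

Lemma special_tile t b : t \in D -> boxin t s.+1 b ->
  [/\ 0 < b, boxin t s b.-1 & boxin t s.+2 b.-1].
Proof.
move: {2}(ht m s.+1 - b) (leqnn (ht m s.+1 - b)) => k; elim: k t b => [|k IHk] t b kb tD tb.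
  by have := v_in vD tD tb; rewrite /inskew; lia.
have /and3P [ob b1 b2] := v_in vD tD tb.
have xm : s.+1 <= size m by rewrite sm ltnW.
have xm' : s < size m by lia.
have xl : s.+1 <= size l by rewrite sl ltnW.
have ocap := ht_capacity dm xm; have ocapl := ht_capacity dl xl.
have [b3|b3] := ltnP b.+2 (ht m s.+1).
  have [|t2 t2D t2b] := v_cov vD (a := s.+1) (b := b.+2).
    by rewrite /inskew; lia.
  have [|_ h1 h2] := IHk t2 b.+2 _ t2D t2b; first by lia.
  case: (v_ci vD t2D) => [/(_ _ _ t2b) h|[t' t'D H]]; first by clear - h b1; lia.
  have [_ h3] := H _ _ t2b; have [c1 c2] := H _ _ h1; have [_ c3] := H _ _ h2.
  rewrite subSS subSS subn0 in h3.
  have <- : t' = t by apply: (v_dis vD) t'D tD h3 tb.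
  have e : b.+2.-1 - 2 = b.-1 by rewrite /= subSS subn1.
  by rewrite -e.
have bE : b = (ht m s.+1).-1 by lia.
clear IHk kb ob b1 b3 ocap ocapl xl.
have [ns nD] := andP ts.
have [i [j [h [ij Ht hS hmin hE]]]] := v_tile vD tD.
have := tb; rewrite Ht => /and3P [is1 s1j /eqP bh].
have R : s.+1 < j -> h s.+2 = b.-1 /\ 0 < b.
  move=> sj; have : boxin t s.+2 (h s.+2) by rewrite Ht eqxx; lia.
  move=> /(v_in vD tD) /and3P [_ _]; have := special_down; have := hS s.+1.
  by rewrite is1 sj => /(_ isT); lia.
have L : i < s.+1 -> h s = b.-1 /\ 0 < b.
  move=> is_; have hs : boxin t s (h s) by rewrite Ht eqxx; lia.
  have := hS s; rewrite s1j andbT -ltnS is_ => /(_ isT) [|hs1]; first by lia.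
  have /and3P [_ _] := v_in vD tD hs.
  have := htS dm xm'; case E: (nth false m s); first by lia.
  move=> e hlt; have [|tD' _] := @top_skew s (leqnn s); first by rewrite E.
  have tE : top_box n m s = t.
    by apply: (v_dis vD) tD' tD _ hs; rewrite boxin_top // ?eqxx ?andTb //; lia.
  by move: tb; rewrite -tE boxin_top ?eqn_leq ?ltnn //; clear - xm sm; lia.
have [ii jj] : i < s.+1 /\ s.+1 < j.
  have hi := hmin s; have hj := hmin s.+2.
  have [ii|ii] := ltnP i s.+1; have [jj|jj] := ltnP s.+1 j => //.
  - have e : j = s.+1 by lia.
    by have := L ii; move: hi hE; rewrite e; lia.
  - have e : i = s.+1 by lia.
    by have := R jj; move: hj hE; rewrite e; lia.
  - case/negP: nD; have -> // : top_box n m s.+1 = t.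
    apply: boxin_ext => u v; rewrite boxin_top ?Ht //; last by lia.
    apply/andP/and3P => [[/eqP -> /eqP ->]|[h1 h2 /eqP ->]].
      by split => //; apply/eqP; lia.
    have -> : u = s.+1 by lia.
    by split => //; apply/eqP; lia.
have [h1 h2] := R jj; have [h3 _] := L ii.
by rewrite !Ht h1 h3 !eqxx; split => //; lia.
Qed.

Lemma special_peak : peak l s.
Proof.
have sl1 : s.+1 < size l by rewrite sl.
have sl0 : s < size l by lia.
have sm1 : s < size m by rewrite sm; lia.
have H : (ht l s).+1 = ht l s.+1 /\ ht l s.+1 = (ht l s.+2).+1.
  have lS := htS dl sl0; have lS1 := htS dl sl1; have mS := htS dm sm1.
  have md := special_down.
  have a0 := v_above vD s; have a1 := v_above vD s.+1; have a2 := v_above vD s.+2.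
  move: (a1); rewrite leq_eqVlt => /orP [/eqP e|lt].
    split; last by move: lS1; case: (nth _ _ _); lia.
    case E: (nth false m s) mS => mS; first by move: lS; case: (nth _ _ _); lia.
    have [|_ ] := @top_skew s (leqnn s); first by rewrite E.
    by move: lS; case: (nth _ _ _); lia.
  have [|t tD tb] := v_cov vD (a := s.+1) (b := (ht l s.+1).+1).
    have h1 := ht_capacity dl (ltnW sl1); have h2 : s.+1 <= size m by lia.
    by have := ht_capacity dm h2; rewrite /inskew; lia.
  have [_ /(v_in vD tD) /and3P [_ h1 _] /(v_in vD tD) /and3P [_ h2 _]] := special_tile tD tb.
  by move: lS lS1; case: (nth _ _ _); case: (nth _ _ _); rewrite /= in h1 h2; lia.
rewrite peakE //; have := htS dl sl0; have := htS dl sl1.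
by case: (nth _ _ _) => //=; case: (nth _ _ _) => //=; lia.
Qed.

Lemma special_pos x : x <= s -> 0 < ht m x.+1.
Proof.
move=> xs; have xm : x < size m by rewrite sm; lia.
have := htS dm xm; case E: (nth false m x); first by lia.
by have [|_ ] := @top_skew x xs; [rewrite E | lia].
Qed.

End Special.

Lemma dyck_nth0 m : is_dyck m -> 0 < size m -> nth false m 0.
Proof. by move=> dm m0; have := htS dm m0; case: ifP => // _; rewrite ht0; lia. Qed.

Lemma updel_dyck m s : is_dyck m -> s.+1 < size m -> ~~ nth false m s.+1 ->
  (forall x, x <= s -> 0 < ht m x.+1) -> is_dyck (updel s m).
Proof.
move=> dm sm ns pos; pose f x := if x <= s then (ht m x.+1).-1 else ht m x.+2.
have m0 : 0 < size m by lia.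
have n0 := dyck_nth0 dm m0.
have szd := size_updel sm.
have e := htS dm sm; rewrite (negbTE ns) in e.
apply: (@dyck_ht _ f _ _ _).1 => [||x].
- by rewrite /f /=; have := htS dm m0; rewrite n0 ht0 => ->.
- rewrite szd /f; case: ifP => [h|_]; last by rewrite ht_oversize //; lia.
  have es : s.+2 = size m by lia.
  have -> : (size m).-2 = s by lia.
  by rewrite e es ht_oversize.
- rewrite szd => xl; have -> : nth false (updel s m) x =
    if x < s then nth false m x.+1 else nth false m x.+2.
    rewrite /updel nth_cat size_takel ?size_behead; last by lia.
    case: ltnP => xs; first by rewrite nth_take // nth_behead.
    by rewrite nth_drop; congr nth; lia.
  rewrite /f; case: (ltngtP x s) => [xs|xs|xs].
  + have xm : x.+1 < size m by lia.
    have := htS dm xm; have := pos _ (ltnW xs); have := pos _ xs.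
    by case: (nth _ _ _); lia.
  + by apply: htS dm _; lia.
  + by rewrite xs e; apply: htS dm _; lia.
Qed.

Definition contract_tiling (n s : nat) (m : seq bool) (D : {set {set box n.+1}}) :
  {set {set box n}} := [set contract s t | t in D :\: ribbon n s m].

Section Contract.

Variables (n s : nat) (l m : seq bool) (D : {set {set box n.+1}}).
Hypotheses (dl : is_dyck l) (sl : size l = 2 * n) (sn : s <= 2 * n).
Hypotheses (dm : is_dyck m) (sm : size m = 2 * n).
Hypothesis vD : valid (ins s l) (upins s m) D.
Hypotheses (ts : tight (upins s m) D s.+1).
Hypothesis nts : forall x, x <= s -> ~~ tight (upins s m) D x.

Let sl' : s <= size l. Proof. by rewrite sl. Qed.
Let sm' : s <= size m. Proof. by rewrite sm. Qed.
Let dil := (ins_dyck dl sl').1.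
Let hl := (ins_dyck dl sl').2.
Let dum := v_dyck vD.
Let hm := (upins_dyck dm sm').2.
Let sil : size (ins s l) = 2 * n.+1.
Proof. by rewrite size_ins sl; lia. Qed.
Let sn' : s.+1 < 2 * n.+1. Proof. by lia. Qed.

Lemma ribbon_sub t : t \in ribbon n s m -> t \in D.
Proof.
case/(ribbon_topP _ dm sm sn) => x xs [nx ->].
by have := nts xs; rewrite /tight nx negbK.
Qed.

Lemma contract_above x : ht l x <= ht m x.
Proof.
have [xs|xs] := leqP x s; last first.
  have := v_above vD x.+2; rewrite hl hm /ins_ht /upins_ht !ifF; try lia.
  by rewrite !subSS subn0.
case: x xs => [|x] xs; first by rewrite ht0.
have xm : x < size m by lia.
have := htS dm xm; case E: (nth false m x).
  have := v_above vD x.+1; rewrite hl hm /ins_ht /upins_ht xs /=.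
  by rewrite ifT ?(ltnW xs) //; lia.
have r : ribbon_rel s m x.+1 (ht m x.+1).+1 by rewrite /ribbon_rel xs /= E eqxx.
have bb := ht_le_size x.+1 dm; rewrite sm in bb.
have rD := ribbon_sub (@ribbonI n _ _ _ _ r _ _).
have := v_in vD (rD _ _) (a := x.+1) (b := (ht m x.+1).+1).
rewrite boxin_bx ?eqxx; try lia.
by rewrite /inskew hl /ins_ht xs; lia.
Qed.

Let insk a b : inskew (ins s l) (upins s m) a b =
  spread_rel s (inskew l m) a b || ribbon_rel s m a b.
Proof. by apply: inskew_spread; rewrite ?sl ?sm //; exact: contract_above. Qed.

Lemma notrib_spread t a b : t \in D -> t \notin ribbon n s m -> boxin t a b ->
  spread_rel s (inskew l m) a b.
Proof.
move=> tD tr tb; have := v_in vD tD tb; rewrite insk => /orP [//|r].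
have [al bl] := boxin_le tb.
have rr := ribbonI r al bl.
case/negP: tr; have <- // : [set bx n.+1 a b] = t.
by apply: (v_dis vD) (ribbon_sub rr) tD _ tb; rewrite boxin_bx // !eqxx.
Qed.

Lemma notrib_col1 t b : t \in D -> t \notin ribbon n s m ->
  boxin t s.+1 b = (0 < b) && boxin t s b.-1.
Proof.
move=> tD tr; apply/idP/andP => [tb|[b0 tb]].
  by have [] := special_tile dil sil vD sn' ts nts tD tb.
have := notrib_spread tD tr tb; rewrite /spread_rel leqnn => h.
have : inskew (ins s l) (upins s m) s.+1 b.
  by rewrite insk /spread_rel ltnn eqxx b0 h.
case/(v_cov vD) => t' t'D t'b.
have [_ h' _] := special_tile dil sil vD sn' ts nts t'D t'b.
by rewrite -(v_dis vD t'D tD h' tb).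
Qed.

Lemma notrib_col2 t b : t \in D -> t \notin ribbon n s m ->
  boxin t s.+2 b = boxin t s b.
Proof.
move=> tD tr; apply/idP/idP => tb; last first.
  have : boxin t s.+1 b.+1 by rewrite notrib_col1.
  by case/(special_tile dil sil vD sn' ts nts tD).
have := notrib_spread tD tr tb; rewrite /spread_rel !ifF; try lia.
rewrite !subSS subn0 => h.
have : inskew (ins s l) (upins s m) s.+1 b.+1.
  by rewrite insk /spread_rel ltnn eqxx h.
case/(v_cov vD) => t' t'D t'b.
have [_ h1 h2] := special_tile dil sil vD sn' ts nts t'D t'b.
by rewrite -(v_dis vD t'D tD h2 tb).
Qed.

Lemma notrib_le t a b : t \in D -> boxin t a b -> b <= 2 * n.
Proof.
move=> tD /(v_in vD tD) /and3P [_ _ h].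
by have := ht_le_size a dum; have := ht_le_abscissa a dum; rewrite (v_size vD); lia.
Qed.

Lemma notribK t : t \in D -> t \notin ribbon n s m -> spread s (contract s t) = t.
Proof.
move=> tD tr; apply: contractK => //.
- by move=> a b; exact: notrib_le.
- by move=> b; exact: notrib_col1.
- by move=> b; exact: notrib_col2.
Qed.

Lemma contract_tilingP t : t \in contract_tiling s m D ->
  exists2 t0, t0 \in D /\ t0 \notin ribbon n s m & t = contract s t0.
Proof. by case/imsetP => t0; rewrite inE => /andP [h1 h2] ->; exists t0. Qed.

Lemma contract_tilingI t : t \in D -> t \notin ribbon n s m ->
  contract s t \in contract_tiling s m D.
Proof. by move=> tD tr; apply: imset_f; rewrite inE tr. Qed.

Lemma boxin_contract_notrib t a b : t \in D -> t \notin ribbon n s m ->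
  boxin (contract s t) a b = contract_rel s (boxin t) a b.
Proof.
move=> tD tr; rewrite boxin_contract.
case E: (contract_rel _ _ _ _); rewrite ?andbF //.
move: E; rewrite /contract_rel; case: ifP => as_ tb.
  by have := notrib_le tD tb; lia.
by have := notrib_le tD tb; have := boxin_le tb; lia.
Qed.

Lemma contract_in t a b : t \in D -> t \notin ribbon n s m ->
  contract_rel s (boxin t) a b -> inskew l m a b.
Proof.
move=> tD tr; rewrite /contract_rel; case: ifP => as_ tb.
  by have := notrib_spread tD tr tb; rewrite /spread_rel as_.
have := notrib_spread tD tr tb; rewrite /spread_rel !ifF; try lia.
by rewrite !subSS subn0.
Qed.

Lemma contract_valid : valid l m (contract_tiling s m D).
Proof.
split => //.
- exact: contract_above.
- move=> t /contract_tilingP [t0 [t0D tr] ->].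
  apply: (contract_dyck_graph (s := s) (p := boxin t0)) => [a b|b|b|].
  + exact: boxin_contract_notrib.
  + exact: notrib_col1.
  + exact: notrib_col2.
  + exact: v_tile vD _ t0D.
- move=> t a b /contract_tilingP [t0 [t0D tr] ->].
  by rewrite boxin_contract_notrib //; exact: contract_in.
- move=> a b h; pose a' := if a <= s then a else a.+2.
  have h' : spread_rel s (inskew l m) a' b.
    rewrite /a' /spread_rel; case: (leqP a s) => as_; first by rewrite as_.
    rewrite !ifF; try lia.
    by rewrite !subSS subn0.
  have [|t tD tb] := v_cov vD (a := a') (b := b); first by rewrite insk h'.
  have tr : t \notin ribbon n s m.
    apply/negP => /ribbonP [u [v [r _ _ _ tE]]]; move: tb; rewrite tE.
    by case/andP => /eqP e1 /eqP e2; apply: (spread_rel_ribbon dm h'); rewrite e1 e2.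
  exists (contract s t); first exact: contract_tilingI.
  rewrite boxin_contract_notrib // /contract_rel; move: tb; rewrite /a'.
  by case: ifP.
- move=> t t' a b /contract_tilingP [t0 [t0D tr] ->] /contract_tilingP [t1 [t1D tr'] ->].
  rewrite !boxin_contract_notrib // => h h'; congr contract; move: h h'.
  by rewrite /contract_rel; case: ifP => _; exact: (v_dis vD).
- move=> t /contract_tilingP [t0 [t0D tr] ->].
  case: (v_ci vD t0D) => [h|[t1 t1D h]].
    left => a b; rewrite boxin_contract_notrib // /contract_rel.
    case: ifP => as_ /h; rewrite hl /ins_ht ?as_ //.
    by rewrite !ifF; try lia; rewrite !subSS subn0.
  right; exists (contract s t1); last first.
    move=> a b; rewrite boxin_contract_notrib //.
    rewrite /contract_rel boxin_contract; case: ifP => as_ tb.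
      have [h1 h2] := h _ _ tb; split => //; rewrite /contract_rel as_ h2.
      by have := notrib_le t0D tb; lia.
    have [h1 h2] := h _ _ tb; split => //; rewrite /contract_rel as_ h2.
    by have := notrib_le t0D tb; have := boxin_le tb; lia.
  apply: contract_tilingI => //; apply/negP => /ribbonP [u [v [r _ _ _ tE]]].
  (* t1 cannot be a ribbon box: these are the topmost boxes of their columns *)
  have [i [j [f [ij Ht _ _ _]]]] := v_tile vD t0D.
  have tb : boxin t0 i (f i) by rewrite Ht ij leqnn eqxx.
  have [h1] := h _ _ tb; rewrite tE => /andP [/eqP e1 /eqP e2].
  have /and3P [_ _] := v_in vD t0D tb.
  have [r1 r2 r3 /eqP r4] := and4P r; have u1 := prednK r1.
  have um : u.-1 < size m by rewrite u1 (leq_trans r2).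
  have := htS dm um; rewrite (negbTE r3) u1; move: h1 e2; rewrite e1 hm /upins_ht.
  have -> : (u == 0) = false by case: (u) r1.
  by rewrite (leqW r2); clear - r4; lia.
Qed.

Lemma contract_tilingK : spread_tiling s m (contract_tiling s m D) = D.
Proof.
apply/setP => t; apply/idP/idP => [/spread_tilingP [[t0 /contract_tilingP [t1 [t1D tr] ->] ->]|]|tD].
- by rewrite notribK.
- exact: ribbon_sub.
- rewrite inE; have [tr|tr] := boolP (t \in ribbon n s m); first by rewrite orbT.
  by rewrite orbF -(notribK tD tr) imset_f // contract_tilingI.
Qed.

End Contract.

(** * Labellings of Lascoux-Schuetzenberger type *)

Lemma big_exists_unique (V : nmodType) (I J : finType) (P : pred I) (K : pred J)
    (R : I -> J -> bool) (F : I -> V) :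
  (forall i, P i -> exists s, R i s) ->
  (forall i s s', P i -> R i s -> R i s' -> s = s') ->
  (forall i s, P i -> R i s -> K s) ->
  (\sum_(i | P i) F i = \sum_(s | K s) \sum_(i | P i && R i s) F i)%R.
Proof.
move=> ex un RK; rewrite (exchange_big_dep P) /=; last by move=> s i _ /andP [].
apply: eq_bigr => i Pi; have [s Rs] := ex _ Pi.
rewrite (big_pred1 s) // => s'; rewrite Pi /=.
apply/andP/eqP => [[_ R']|->]; last by split => //; apply: RK Rs.
exact: un R' Rs.
Qed.

Lemma big_bij_dep (V : nmodType) (I J : finType) (P : pred I) (Q : pred J)
    (f : I -> J) (g : J -> I) (F : I -> V) (G : J -> V) :
  (forall i, P i -> Q (f i) /\ g (f i) = i) ->
  (forall j, Q j -> [/\ P (g j), f (g j) = j & F (g j) = G j]) ->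
  (\sum_(i | P i) F i = \sum_(j | Q j) G j)%R.
Proof.
move=> PQ QP; rewrite (reindex_onto g f) /=; last by move=> i /PQ [].
apply: eq_big => [j|j /andP [Pj /eqP e]].
  apply/andP/idP => [[/PQ [h _] /eqP e]|/QP [h -> _]]; first by rewrite -e.
  by rewrite eqxx.
by have [h _] := PQ _ Pj; have [] := QP _ h; rewrite e.
Qed.

Definition nested (l : seq bool) (i j : nat) : Prop :=
  [/\ nth false l i, nth false l j, i < j &
      forall x, i < x <= j -> ht l i < ht l x].

Lemma nth_true_size l i : nth false l i -> i < size l.
Proof. by apply: contraTT; rewrite -leqNgt => ?; rewrite nth_default. Qed.

Lemma capacityS l x : x < size l -> capacity l x.+1 = capacity l x + ~~ nth false l x.
Proof. by move=> xl; rewrite /capacity count_takeS. Qed.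

Lemma matchUDP l i j : is_dyck l -> matchUD l i j <->
  [/\ nth false l i, ~~ nth false l j, i < j, ht l j.+1 = ht l i &
      forall x, x <= size l -> i < x <= j -> ht l i < ht l x].
Proof.
move=> dl; rewrite /matchUD !height_ht //; split.
  case/and5P => h1 h2 h3 /eqP [h4] /forallP h5; split => // x xl xij.
  have := h5 (Ordinal (xl : x < (size l).+1)); rewrite !height_ht //= xij /=.
  by rewrite ltz_nat.
case=> h1 h2 h3 h4 h5; apply/and5P; split => //; first by rewrite h4.
apply/forallP => x; apply/implyP => xij; rewrite !height_ht // ltz_nat.
by apply: h5 => //; rewrite -ltnS.
Qed.

Lemma match_exists l i : is_dyck l -> nth false l i ->
  exists2 j, j < size l & matchUD l i j.
Proof.
move=> dl ni; have il := nth_true_size ni.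
have ex : exists x, (i < x) && (ht l x <= ht l i).
  by exists (size l); rewrite il ht_oversize.
case: (ex_minnP ex) => x /andP [ix hx] mn.
have xl : x <= size l by apply: mn; rewrite il ht_oversize.
have iS := htS dl il; rewrite ni in iS.
case: x ix hx mn xl => // x; rewrite ltnS => ix hx mn xl.
have ix' : i < x.
  by move: ix; rewrite leq_eqVlt => /orP [/eqP e|//]; move: hx; rewrite -e iS ltnn.
have gt y : i < y <= x -> ht l i < ht l y.
  move=> /andP [iy yx]; rewrite ltnNge; apply/negP => hy.
  by have := mn y; rewrite iy hy => /(_ isT); rewrite leqNgt ltnS yx.
have hx' := gt x; rewrite ix' leqnn in hx'; have {}hx' := hx' isT.
have xS := htS dl xl; exists x => //; apply/matchUDP => //.
case: (nth false l x) xS => xS; first by move: hx; rewrite xS leqNgt ltnW.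
split => //; last by move=> y _; exact: gt.
by apply/eqP; rewrite eqn_leq hx -ltnS -xS hx'.
Qed.

Lemma chordE l i : is_dyck l -> chord l i = nth false l i.
Proof.
move=> dl; apply/existsP/idP => [[j /and5P [] //]|/(match_exists dl) [j jl m]].
by exists (Ordinal jl).
Qed.

Lemma containsP l i j : is_dyck l -> contains l i j <-> nested l i j.
Proof.
move=> dl; split.
  case/existsP => a /existsP [b] /and4P [/(matchUDP _ _ dl) [h1 h2 h3 h4 h5]].
  move=> /(matchUDP _ _ dl) [g1 g2 g3 g4 g5] ij ba; split => // x /andP [x1 x2].
  have al := ltn_ord a.
  by apply: h5; lia.
case=> ni nj ij H; have [a al ma] := match_exists dl ni.
have [b bl mb] := match_exists dl nj.
apply/existsP; exists (Ordinal al); apply/existsP; exists (Ordinal bl).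
rewrite /= ma mb ij /=.
have [_ na ia ea Ha] := (matchUDP i a dl).1 ma.
have [_ nb jb eb Hb] := (matchUDP j b dl).1 mb.
have hij := H j; rewrite ij leqnn in hij; have {}hij := hij isT.
rewrite ltnNge; apply/negP => ab.
have [ja|aj] := ltnP a j; first by have := H a.+1; rewrite ea ltnn; lia.
have ne : a != j by apply: contraNneq na => ->.
move: ab; rewrite leq_eqVlt => /orP [/eqP e|ab].
  by move: hij; rewrite -eb -e ea ltnn.
by have := Hb a.+1; rewrite ea; lia.
Qed.

Definition LS_fun (l : seq bool) (f : nat -> nat) : Prop :=
  [/\ forall i, ~~ nth false l i -> f i = 0,
      forall i j, nested l i j -> f i <= f j &
      forall i, f i <= capacity l i].

Definition fun_of_labelling (n m : nat) (nu : {ffun 'I_n -> 'I_m}) (i : nat) : nat :=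
  if insub i is Some k then nu k : nat else 0.

Lemma fun_of_labellingE n m (nu : {ffun 'I_n -> 'I_m}) (i : 'I_n) :
  fun_of_labelling nu i = nu i.
Proof. by rewrite /fun_of_labelling valK. Qed.

Lemma fun_of_labelling_oversize n m (nu : {ffun 'I_n -> 'I_m}) i :
  n <= i -> fun_of_labelling nu i = 0.
Proof. by move=> ni; rewrite /fun_of_labelling insubF // ltnNge ni. Qed.

(* Along a run of U steps the capacity is constant and labels do not decrease,
   so a bound at the leaves is a bound at every chord. *)
Lemma label_le_capacity l f : is_dyck l ->
  (forall i j, nested l i j -> f i <= f j) ->
  (forall i, leaf l i -> f i <= capacity l i) ->
  forall i, nth false l i -> f i <= capacity l i.
Proof.
move=> dl mono lf i; move: {2}(size l - i) (leqnn (size l - i)) => k.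
elim: k i => [|k IHk] i ki ni; have il := nth_true_size ni; first by lia.
have iS := htS dl il; rewrite ni in iS.
have i1 : i.+1 < size l.
  rewrite ltn_neqAle il andbT; apply/eqP => e.
  by move: iS; rewrite ht_oversize // e.
have iS1 := htS dl i1; case E: (nth false l i.+1) iS1 => iS1; last first.
  apply: lf; apply/matchUDP => //; split => //; [by rewrite E | by lia |].
  move=> x _ /andP [x1 x2]; have -> : x = i.+1 by lia.
  by lia.
have n1 : nested l i i.+1.
  split => // x /andP [x1 x2]; have -> : x = i.+1 by lia.
  by lia.
apply: leq_trans (mono _ _ n1) _.
have := IHk i.+1; rewrite E capacityS // ni addn0; apply => //.
by lia.
Qed.

Lemma LS_labellingP n l nu : is_dyck l -> size l = 2 * n ->
  LS_labelling n l nu <-> LS_fun l (fun_of_labelling nu).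
Proof.
move=> dl sl; split.
  case/and3P => /forallP h0 /forallP hp /forallP hl.
  have z i : ~~ nth false l i -> fun_of_labelling nu i = 0.
    move=> ni; have [il|il] := ltnP i (2 * n); last exact: fun_of_labelling_oversize.
    have := h0 (Ordinal il); rewrite chordE // ni /= => /eqP.
    by rewrite -fun_of_labellingE.
  have mono i j : nested l i j -> fun_of_labelling nu i <= fun_of_labelling nu j.
    move: {2}(j - i) (leqnn (j - i)) => k; elim: k i j => [|k IHk] i j ji nij.
      by case: nij; lia.
    have [ni nj ij H] := nij; have il := nth_true_size ni; have jl := nth_true_size nj.
    have [p|np] := boolP (parent l i j).
      rewrite sl in il jl; have := hp (Ordinal il) => /forallP /(_ (Ordinal jl)).
      by rewrite /= p /= -!fun_of_labellingE.
    have cij : contains l i j by apply/containsP.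
    move: np; rewrite /parent cij /= negb_forall => /existsP [m].
    rewrite negb_imply negb_or => /and3P [/(containsP _ _ dl) [nm _ mj Hm] mi nc].
    have im : i < m.
      rewrite ltn_neqAle eq_sym mi /= leqNgt; apply/negP => lt.
      case/negP: nc; apply/containsP => //; split => // x /andP [x1 x2].
      by apply: Hm; lia.
    apply: (@leq_trans (fun_of_labelling nu m)); apply: IHk; try lia.
      by split => // x /andP [x1 x2]; apply: H; lia.
    by split.
  split => // i; have [ni|ni] := boolP (nth false l i); last by rewrite z.
  apply: label_le_capacity => // {ni}i lf.
  have il : i < 2 * n by case/and5P: (lf) => /nth_true_size; rewrite sl.
  by have := hl (Ordinal il); rewrite lf /= -fun_of_labellingE.
case=> z mono cap; apply/and3P; split; apply/forallP => i.
- by rewrite chordE //; apply/implyP => /z; rewrite fun_of_labellingE => ->.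
- apply/forallP => j; apply/implyP => /andP [/(containsP _ _ dl) /mono h _].
  by rewrite -!fun_of_labellingE.
- by apply/implyP => _; rewrite -fun_of_labellingE.
Qed.

Lemma sigmaE n l nu : is_dyck l -> LS_fun l (fun_of_labelling nu) ->
  sigma n l nu = \sum_(0 <= i < 2 * n) fun_of_labelling nu i.
Proof.
move=> dl [z _ _]; rewrite /sigma big_mkord big_mkcond; apply: eq_bigr => i _.
by rewrite chordE // -fun_of_labellingE; case: ifP => // /negbT /z ->.
Qed.

Lemma capacity_le n l x : is_dyck l -> size l = 2 * n -> capacity l x <= n.
Proof.
move=> dl sl; have [xl|xl] := leqP x (size l).
  by have := ht_capacity dl xl; lia.
have -> : capacity l x = capacity l (size l).
  by rewrite /capacity take_size take_oversize // ltnW.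
by have := ht_capacity dl (leqnn (size l)); lia.
Qed.

Definition ins_label (s k : nat) (f : nat -> nat) (x : nat) : nat :=
  if x < s then f x else if x == s then k else if x == s.+1 then 0 else f (x - 2).

Definition del_label (s : nat) (f : nat -> nat) (x : nat) : nat :=
  if x < s then f x else f x.+2.

Definition last_tight (l : seq bool) (f : nat -> nat) (s : nat) : Prop :=
  [/\ nth false l s, f s = capacity l s &
      forall x, s < x -> nth false l x -> f x < capacity l x].

Lemma capacity_ins s l x : is_dyck l -> s <= size l -> x <= (size l).+2 ->
  capacity (ins s l) x = if x <= s then capacity l x
    else if x == s.+1 then capacity l s else (capacity l (x - 2)).+1.
Proof.
move=> dl sl xl; have [di H] := ins_dyck dl sl.
have := @ht_capacity (ins s l) x di; rewrite size_ins xl H /ins_ht => /(_ isT).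
case: ifP => xs; first by have := @ht_capacity l x dl; lia.
case: ifP => [/eqP ->|xs']; first by have := ht_capacity dl sl; lia.
by have := @ht_capacity l (x - 2) dl; lia.
Qed.

Lemma capacity_mono l x y : x <= y -> capacity l x <= capacity l y.
Proof.
move=> xy; rewrite /capacity -[take y l](cat_take_drop x) count_cat take_takel //.
exact: leq_addr.
Qed.

Lemma ins_label_LS s l f : is_dyck l -> s <= size l -> LS_fun l f ->
  (forall i, size l <= i -> f i = 0) ->
  LS_fun (ins s l) (ins_label s (capacity l s) f) /\
  last_tight (ins s l) (ins_label s (capacity l s) f) s.
Proof.
move=> dl sl [z mono cap] fo; have [di H] := ins_dyck dl sl.
have capi x : ins_label s (capacity l s) f x <= capacity (ins s l) x.
  have [xl|xl] := leqP x (size l).+2; last first.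
    by rewrite /ins_label !ifF ?fo //; lia.
  rewrite capacity_ins // /ins_label; case: (ltngtP x s) => xs.
  - exact: cap.
  - by case: ifP => // _; rewrite leqW.
  - by rewrite xs.
split; last first.
  split.
  - by rewrite nth_ins // ltnn eqxx.
  - by rewrite capacity_ins // ?leqnn /ins_label ?ltnn ?eqxx //; lia.
  move=> x sx nx; have xl := nth_true_size nx; rewrite size_ins in xl.
  rewrite capacity_ins //; last exact: ltnW.
  move: nx; rewrite nth_ins // /ins_label.
  by case: (ltngtP x s) sx => // sx _; case: ifP => // _ _; rewrite ltnS.
split => //.
- move=> i; rewrite nth_ins // /ins_label; case: ifP => // _; first exact: z.
  by case: ifP => // _; case: ifP => // _; exact: z.
- move=> i j [ni nj ij Hx]; rewrite !nth_ins // in ni nj.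
  have i1 : i != s.+1 by apply: contraTneq ni => ->; rewrite ltnNge leqnSn /= eqxx; case: ifP => //; lia.
  have j1 : j != s.+1 by apply: contraTneq nj => ->; rewrite ltnNge leqnSn /= eqxx; case: ifP => //; lia.
  have i0 : i != s.
    apply/eqP => e; have := Hx s.+2; rewrite !H /ins_ht e leqnn !ifF; try lia.
    by rewrite !subSS subn0 ltnn; lia.
  have [js|js] := eqVneq j s.
    rewrite /ins_label js ltnn eqxx; have is_ : i < s by lia.
    by rewrite is_; apply: leq_trans (cap i) _; apply: capacity_mono; exact: ltnW.
  pose u y := if y < s then y else y - 2.
  have fu y : y != s -> y != s.+1 -> ins_label s (capacity l s) f y = f (u y).
    by rewrite /ins_label /u => /negbTE -> /negbTE ->; case: ifP.
  have hu y : y != s -> y != s.+1 -> ht (ins s l) y = ht l (u y).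
    by rewrite H /ins_ht /u leq_eqVlt => /negbTE -> /negbTE -> /=; case: (y < s).
  rewrite !fu //; apply: mono; split.
  + by move: ni; rewrite (negbTE i0) (negbTE i1) /u; case: ifP.
  + by move: nj; rewrite (negbTE js) (negbTE j1) /u; case: ifP.
  + by rewrite /u; case: ifP; case: ifP; clear - ij i0 i1 j1 js; lia.
  + move=> x; rewrite -hu //; case: (ltnP x s) => xs xij.
      rewrite (_ : ht l x = ht (ins s l) x); last by rewrite H /ins_ht ltnW.
      by apply: Hx; move: xij; rewrite /u; do 2 case: ifP; clear - xs i0 i1 j1 js; lia.
    rewrite (_ : ht l x = ht (ins s l) x.+2); last first.
      by rewrite H /ins_ht !ifF ?subSS ?subn0 //; clear - xs; lia.
    by apply: Hx; move: xij; rewrite /u; do 2 case: ifP; clear - xs i0 i1 j1 js; lia.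
Qed.

Lemma last_tight_peak l s f : is_dyck l -> LS_fun l f -> last_tight l f s -> peak l s.
Proof.
move=> dl [z mono cap] [ns fs lt]; have sl := nth_true_size ns.
have sS := htS dl sl; rewrite ns in sS.
have s1 : s.+1 < size l.
  rewrite ltn_neqAle sl andbT; apply/eqP => e.
  by move: sS; rewrite ht_oversize // e.
rewrite peakE // ns /=; apply/negP => n1.
have nn : nested l s s.+1.
  by split => // x xs; have -> : x = s.+1 by [lia]; rewrite sS.
have := mono _ _ nn; rewrite fs leqNgt => /negP; apply.
by have := lt _ (leqnn _) n1; rewrite capacityS // ns addn0.
Qed.

Lemma del_label_LS s l f : is_dyck l -> s <= size l -> LS_fun (ins s l) f ->
  last_tight (ins s l) f s ->
  LS_fun l (del_label s f) /\ ins_label s (capacity l s) (del_label s f) =1 f.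
Proof.
move=> dl sl [z mono cap] [ns fs lt]; have [di H] := ins_dyck dl sl.
have nu y : nth false l y = nth false (ins s l) (if y < s then y else y.+2).
  rewrite nth_ins //; case: (ltnP y s) => ys; first by rewrite ys.
  by rewrite !ifF ?subSS ?subn0 //; lia.
split; last first.
  move=> x; rewrite /ins_label /del_label; case: (ltngtP x s) => xs //.
    case: eqP => [->|ne]; first by rewrite z // nth_ins // ltnNge leqnSn /= eqxx ifF //; lia.
    by rewrite ifF; [congr f | ]; lia.
  by rewrite xs fs capacity_ins ?leqnn //; lia.
split.
- move=> i; rewrite nu /del_label; case: ifP => _; exact: z.
- move=> i j [ni nj ij Hx].
  have fu y : del_label s f y = f (if y < s then y else y.+2).
    by rewrite /del_label; case: ifP.
  rewrite !fu; apply: mono; rewrite !nu in ni nj; split => //.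
    by do 2 case: ifP; clear - ij; lia.
  have hu y : ht (ins s l) (if y < s then y else y.+2) = ht l y.
    rewrite H /ins_ht; case: (ltnP y s) => ys; first by rewrite ltnW.
    by rewrite !ifF ?subSS ?subn0 //; clear - ys; lia.
  move=> x; rewrite hu H /ins_ht => xij.
  case: (leqP x s) => xs.
    by apply: Hx; move: xij; do 2 case: ifP; clear - xs ij; lia.
  case: eqP => [e|ne].
    by apply: leq_trans (Hx s _) _ => //; move: xij; do 2 case: ifP; clear - xs ij e; lia.
  by apply: Hx; move: xij; do 2 case: ifP; clear - xs ij ne; lia.
- move=> i; rewrite /del_label; case: ifP => is_.
    have h : i <= (size l).+2 by lia.
    by have := cap i; rewrite capacity_ins // (ltnW is_).
  have [il|il] := ltnP i (size l); last by rewrite z // nth_default // size_ins.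
  have [ni|ni] := boolP (nth false (ins s l) i.+2); last by rewrite z.
  have si : s < i.+2 by lia.
  have h : i.+2 <= (size l).+2 by lia.
  by have := lt _ si ni; rewrite capacity_ins // !ifF ?subSS ?subn0 ?ltnS //; lia.
Qed.

Lemma last_tight_exists l f : is_dyck l -> 0 < size l -> LS_fun l f ->
  exists s : 'I_(size l), last_tight l f s.
Proof.
move=> dl l0 [z mono cap]; pose P := [pred x : 'I_(size l) | nth false l x && (f x == capacity l x)].
have n0 : nth false l 0.
  by have := htS dl l0; case: ifP => // _; rewrite ht0; lia.
have P0 : P (Ordinal l0).
  by have := cap 0; rewrite /= n0 /capacity take0 leqn0.
case: (arg_maxnP (fun x : 'I_(size l) => x : nat) P0) => s /= /andP [ns /eqP fs] mx.
exists s; split => // x sx nx; rewrite ltn_neqAle cap andbT; apply/negP => fx.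
by have := mx (Ordinal (nth_true_size nx)); rewrite /= nx fx leqNgt sx => /(_ isT).
Qed.

Lemma last_tight_unique l f s s' : last_tight l f s -> last_tight l f s' -> s = s'.
Proof.
move=> [ns fs lt] [ns' fs' lt']; case: (ltngtP s s') => // h.
  by have := lt _ h ns'; rewrite fs' ltnn.
by have := lt' _ h ns; rewrite fs ltnn.
Qed.

Definition last_tightb (l : seq bool) (f : nat -> nat) (s : nat) : bool :=
  [&& nth false l s, f s == capacity l s &
    [forall x : 'I_(size l), (s < x) && nth false l x ==> (f x < capacity l x)]].

Lemma last_tightP l f s : reflect (last_tight l f s) (last_tightb l f s).
Proof.
apply: (iffP and3P) => [[ns /eqP fs /forallP H]|[ns fs H]]; split => //.
- move=> x sx nx; have := H (Ordinal (nth_true_size nx)).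
  by rewrite /= sx nx.
- exact/eqP.
- by apply/forallP => x; apply/implyP => /andP [sx]; exact: H.
Qed.

Definition labelling_of (n m : nat) (f : nat -> nat) : {ffun 'I_n -> 'I_m.+1} :=
  [ffun i : 'I_n => inord (f i)].

Lemma labelling_ofK n m f : (forall i, f i <= m) -> (forall i, n <= i -> f i = 0) ->
  fun_of_labelling (labelling_of n m f) =1 f.
Proof.
move=> fm f0 i; have [il|il] := ltnP i n; last by rewrite fun_of_labelling_oversize ?f0.
rewrite -[i]/(Ordinal il : nat) fun_of_labellingE ffunE inordK //.
by rewrite ltnS; exact: fm.
Qed.

Lemma fun_of_labelling_ext n m (nu nu' : {ffun 'I_n -> 'I_m}) :
  fun_of_labelling nu =1 fun_of_labelling nu' -> nu = nu'.
Proof.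
by move=> H; apply/ffunP => i; apply: val_inj; rewrite /= -!fun_of_labellingE.
Qed.

Lemma LS_fun_ext l f g : f =1 g -> LS_fun l f -> LS_fun l g.
Proof.
move=> e [z mono cap]; split.
- by move=> i /z; rewrite e.
- by move=> i j /mono; rewrite !e.
- by move=> i; rewrite -e.
Qed.

Lemma last_tight_ext l f g s : f =1 g -> last_tight l f s -> last_tight l g s.
Proof. by move=> e [ns fs H]; split; rewrite -?e // => x sx nx; rewrite -e H. Qed.

Lemma sum_ins_label s k f N : s <= N ->
  \sum_(0 <= i < N.+2) ins_label s k f i = k + \sum_(0 <= i < N) f i.
Proof.
move=> sN; rewrite (@big_cat_nat _ _ _ s) //=; last by lia.
rewrite [in RHS](@big_cat_nat _ _ _ s) //= addnCA; congr (_ + _).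
  by apply: eq_big_nat => i /andP [_ is_]; rewrite /ins_label is_.
rewrite big_ltn; last by lia.
rewrite big_ltn; last by lia.
rewrite {1 2}/ins_label ltnn eqxx ltnNge leqnSn eqxx /=.
rewrite (_ : (s.+1 == s) = false) ?add0n; last by lia.
congr (_ + _); rewrite -[s.+2]addn2 big_addn subSS subSS subn0.
apply: eq_big_nat => i /andP [si _]; rewrite /ins_label addnK !ifF //; lia.
Qed.

Lemma capacity_peak l s : is_dyck l -> peak l s -> capacity (del s l) s = capacity l s.
Proof.
move=> dl pl; rewrite -{2}(delK pl); have := peak_size pl => sl.
by rewrite capacity_ins ?leqnn ?del_dyck ?size_del //; lia.
Qed.

Section LabellingRecursion.

Local Open Scope ring_scope.

Lemma P_LS_rec n l : is_dyck l -> size l = (2 * n.+1)%N ->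
  P_LS n.+1 l = \sum_(s : 'I_(2 * n.+1) | peak l s) 'X^(capacity l s) * P_LS n (del s l).
Proof.
move=> dl sl; rewrite /P_LS (big_exists_unique (K := fun s : 'I_(2 * n.+1) => peak l s)
  (R := fun nu (s : 'I_(2 * n.+1)) => last_tightb l (fun_of_labelling nu) s)).
- apply: eq_bigr => s pl; rewrite big_distrr /=.
  have s1 := peak_size pl.
  have dd := del_dyck dl pl.
  have sd : size (del s l) = (2 * n)%N by rewrite size_del //; lia.
  have sd' : (s <= size (del s l))%N by lia.
  have Ed := delK pl; have Ec := capacity_peak dl pl.
  have G0 nu' : LS_labelling n (del s l) nu' ->
      let f := ins_label s (capacity l s) (fun_of_labelling nu') in
      [/\ LS_fun l f, last_tight l f s &
       fun_of_labelling (labelling_of (2 * n.+1) n.+1 f) =1 f].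
    move=> /(LS_labellingP _ dd sd) L f.
    have [|] := ins_label_LS dd sd' L.
      by move=> i; rewrite sd; exact: fun_of_labelling_oversize.
    rewrite Ed Ec => L1 L2; split => //; apply: labelling_ofK.
      by have [_ _ cap] := L1 => i; apply: leq_trans (cap i) (capacity_le _ dl sl).
    by have [z _ _] := L1 => i il; apply: z; rewrite nth_default // sl.
  have F0 nu : LS_labelling n.+1 l nu -> last_tight l (fun_of_labelling nu) s ->
      let f := del_label s (fun_of_labelling nu) in
      [/\ LS_fun (del s l) f, ins_label s (capacity l s) f =1 fun_of_labelling nu &
       fun_of_labelling (labelling_of (2 * n) n f) =1 f].
    move=> /(LS_labellingP _ dl sl) L T f.
    have [||] := @del_label_LS s (del s l) (fun_of_labelling nu) dd sd'; rewrite ?Ed //.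
    rewrite Ec => L1 L2; split => //; apply: labelling_ofK.
      by have [_ _ cap] := L1 => i; apply: leq_trans (cap i) (capacity_le _ dd sd).
    by have [z _ _] := L1 => i il; apply: z; rewrite nth_default // sd.
  apply: (big_bij_dep
    (f := fun nu => labelling_of (2 * n) n (del_label s (fun_of_labelling nu)))
    (g := fun nu' => labelling_of (2 * n.+1) n.+1
            (ins_label s (capacity l s) (fun_of_labelling nu')))).
    move=> nu /andP [L /last_tightP T]; have [h1 h2 h3] := F0 _ L T; split.
      by apply/LS_labellingP => //; apply: LS_fun_ext h1 => x; rewrite h3.
    have L' : LS_labelling n (del s l)
        (labelling_of (2 * n) n (del_label s (fun_of_labelling nu))).
      by apply/LS_labellingP => //; apply: LS_fun_ext h1 => x; rewrite h3.
    have [_ _ h4] := G0 _ L'.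
    apply: fun_of_labelling_ext => x; rewrite h4 -h2 /ins_label.
    by do 3 (case: ifP => // _); rewrite h3.
  move=> nu' L'; have [h1 h2 h3] := G0 _ L'.
  have L : LS_labelling n.+1 l (labelling_of (2 * n.+1) n.+1
      (ins_label s (capacity l s) (fun_of_labelling nu'))).
    by apply/LS_labellingP => //; apply: LS_fun_ext h1 => x; rewrite h3.
  have T : last_tight l (fun_of_labelling (labelling_of (2 * n.+1) n.+1
      (ins_label s (capacity l s) (fun_of_labelling nu')))) s.
    by apply: last_tight_ext h2 => x; rewrite h3.
  have [_ _ h4] := F0 _ L T; split.
  + by rewrite L; apply/last_tightP.
  + apply: fun_of_labelling_ext => x; rewrite h4 /del_label !h3 /ins_label.
    case: (ltnP x s) => // xs.
    by rewrite !ifF ?subSS ?subn0 //; clear - xs; lia.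
  + rewrite -exprD; congr 'X^_.
    rewrite !sigmaE //; [|by apply/LS_labellingP|by apply/LS_labellingP].
    rewrite -(@sum_ins_label s) //; last by rewrite -sd.
    rewrite (eq_bigr _ (fun i _ => h3 i)).
    by congr (\big[addn/0%N]_(0 <= i < _) _); lia.
- move=> nu /(LS_labellingP _ dl sl) L.
  have [|s T] := last_tight_exists dl _ L; first by rewrite sl; lia.
  have s2 : (s < 2 * n.+1)%N by rewrite -sl.
  by exists (Ordinal s2); apply/last_tightP.
- move=> nu s s' _ /last_tightP T /last_tightP T'.
  by apply: val_inj; exact: last_tight_unique T T'.
- move=> nu s /(LS_labellingP _ dl sl) L /last_tightP T.
  exact: last_tight_peak dl L T.
Qed.

End LabellingRecursion.

(** * The recursion for tilings *)

Lemma card_box n (P : nat -> nat -> bool) :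
  #|[set x : box n | P x.1 x.2]| =
  \sum_(0 <= a < (2 * n).+1) \sum_(0 <= b < (2 * n).+1) P a b.
Proof.
transitivity (\sum_(a < (2 * n).+1) \sum_(b < (2 * n).+1) (P a b : nat)); last first.
  by rewrite big_mkord; apply: eq_bigr => a _; rewrite big_mkord.
rewrite -sum1_card pair_bigA /= big_mkcond; apply: eq_bigr => x _.
by rewrite inE; case: (P _ _).
Qed.

Lemma sum_eq_indicator N v : \sum_(0 <= b < N) (b == v) = (v < N).
Proof.
elim: N => [|N IHN]; first by rewrite big_nil.
by rewrite big_nat_recr //= IHN; lia.
Qed.

Lemma sum_column a h k N : odd h = odd a -> odd k = odd a -> k <= N ->
  \sum_(0 <= b < N) (odd (a + b) && (h < b < k)) = (k - h)./2.
Proof.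
move=> ho ko kN.
have -> : k = minn N k by lia.
have E M : \sum_(0 <= b < M) (odd (a + b) && (h < b < k)) = (minn M k - h)./2.
  elim: M => [|M IHM]; first by rewrite big_nil min0n.
  by rewrite big_nat_recr //= IHM; lia.
by rewrite -E; have -> : minn N k = k by lia.
Qed.

Lemma area_valid n l m (D : {set {set box n}}) : is_dyck l -> size l = 2 * n ->
  valid l m D -> area n D = \sum_(0 <= a < (2 * n).+1) (ht m a - ht l a)./2.
Proof.
move=> dl sl vD; have dm := v_dyck vD; have sm := v_size vD.
have -> : area n D = #|[set x : box n | inskew l m x.1 x.2]|.
  apply: eq_card => x; rewrite inE; apply/bigcupP/idP => [[t tD xt]|].
    by apply: (v_in vD tD); rewrite boxin_val.
  by case/(v_cov vD) => t tD; rewrite boxin_val; exists t.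
rewrite card_box; apply: eq_big_nat => a /andP [_ an].
rewrite /inskew sum_column //.
- by rewrite odd_ht // sl.
- by rewrite odd_ht // sm.
- by have := ht_le_size a dm; rewrite sm; lia.
Qed.

Lemma sum_downs m s : s <= size m ->
  \sum_(0 <= a < s.+1) ((0 < a) && ~~ nth false m a.-1) = capacity m s.
Proof.
elim: s => [|s IHs] sm; first by rewrite big_nat1 /capacity take0.
by rewrite big_nat_recr //= IHs 1?ltnW // capacityS.
Qed.

Lemma area_spread n l m s (D : {set {set box n}}) : is_dyck l -> size l = 2 * n ->
  s <= 2 * n -> valid l m D ->
  area n.+1 (spread_tiling s m D) = area n D + 2 * (ht m s - ht l s)./2 + capacity m s.
Proof.
move=> dl sl sn vD; have dm := v_dyck vD; have sm := v_size vD.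
have sl' : s <= size l by rewrite sl.
have sm' : s <= size m by rewrite sm.
have [dil hl] := ins_dyck dl sl'; have [dum hm] := upins_dyck dm sm'.
rewrite (area_valid dl sl vD) (area_valid dil _ (spread_valid dl sl sn vD)); last first.
  by rewrite size_ins sl; lia.
rewrite -(sum_downs sm').
rewrite (@big_cat_nat _ _ _ s.+1) //=; last by lia.
rewrite [in RHS](@big_cat_nat _ _ _ s.+1) //=.
rewrite (big_ltn (m := s.+1)); last by lia.
have -> : \sum_(0 <= i < s.+1) (ht (upins s m) i - ht (ins s l) i)./2 =
    \sum_(0 <= i < s.+1) (ht m i - ht l i)./2 +
    \sum_(0 <= a < s.+1) ((0 < a) && ~~ nth false m a.-1).
  rewrite -big_split /=; apply: eq_big_nat => a /andP [_]; rewrite ltnS => as_.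
  rewrite hl hm /ins_ht /upins_ht as_ (leqW as_).
  case: a as_ => [|a] as_ /=; first by rewrite ht0 addn0.
  have am : a < size m by lia.
  have wa := v_above vD a.+1.
  by have := htS dm am; case: (nth _ _ _) => /= h; lia.
have -> : \sum_(s.+2 <= i < (2 * n.+1).+1) (ht (upins s m) i - ht (ins s l) i)./2 =
    \sum_(s <= i < (2 * n).+1) (ht m i - ht l i)./2.
  rewrite -[s.+2]addn2 big_addn; have -> : (2 * n.+1).+1 - 2 = (2 * n).+1 by lia.
  apply: eq_big_nat => a /andP [sa _].
  by rewrite hl hm /ins_ht /upins_ht !ifF ?addnK //; lia.
rewrite [X in _ + (_ + X)]big_ltn; last by lia.
rewrite hl hm /ins_ht /upins_ht leqnn ltnn eqxx /= subSS; lia.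
Qed.

Lemma card_ribbon n s m : is_dyck m -> size m = 2 * n -> s <= 2 * n ->
  #|ribbon n s m| = capacity m s.
Proof.
move=> dm sm sn; have sm' : s <= size m by rewrite sm.
rewrite card_imset; last exact: set1_inj.
rewrite (card_box n.+1 (ribbon_rel s m)) -(sum_downs sm').
rewrite (@big_cat_nat _ _ _ s.+1) //=; last by lia.
rewrite [X in _ + X]big1_seq ?addn0.
  apply: eq_big_nat => a /andP [_]; rewrite ltnS => as_; rewrite /ribbon_rel as_ /=.
  case: (0 < a) => /=; last by rewrite big1.
  case: (~~ _) => /=; last by rewrite big1.
  by rewrite sum_eq_indicator; have := ht_le_size a dm; rewrite sm; lia.
move=> a /=; rewrite mem_index_iota => /andP [as_ _]; rewrite big1 // => b _.
by rewrite /ribbon_rel (leqNgt a) as_ andbF.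
Qed.

Lemma spread_ribbon_disjoint n s l m (D : {set {set box n}}) t :
  valid l m D -> t \in D -> spread s t \notin ribbon n s m.
Proof.
move=> vD tD; apply/negP => /ribbonP [a [b [r _ _ _ tE]]].
have := tE a b; rewrite !eqxx boxin_spread => h.
apply: (@spread_rel_ribbon l m s a b (v_dyck vD) _ r).
by move: h; rewrite /spread_rel; case: ifP => _; [|case: ifP => _];
  rewrite ?andbT; [| case/andP => -> |]; exact: (v_in vD tD).
Qed.

Lemma tiles_spread n s l m (D : {set {set box n}}) : valid l m D -> s <= 2 * n ->
  tiles n.+1 (spread_tiling s m D) = tiles n D + capacity m s.
Proof.
move=> vD sn; rewrite /tiles /spread_tiling cardsU.
rewrite (_ : _ :&: _ = set0) ?cards0 ?subn0.
  rewrite (card_imset _ (can_inj (@spreadK n s))).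
  by rewrite (card_ribbon (v_dyck vD) (v_size vD)).
apply/setP => t; rewrite !inE; apply/negP => /andP [/imsetP [t0 t0D ->]].
by apply/negP; exact: spread_ribbon_disjoint vD t0D.
Qed.

Lemma art_spread n s l m (D : {set {set box n}}) : is_dyck l -> size l = 2 * n ->
  s <= 2 * n -> valid l m D ->
  art n.+1 (spread_tiling s m D) = capacity l s + art n D.
Proof.
move=> dl sl sn vD; rewrite /art (area_spread dl) // (tiles_spread vD) //.
have h1 : s <= size l by rewrite sl.
have h2 : s <= size m by rewrite (v_size vD).
have := ht_capacity dl h1; have := ht_capacity (v_dyck vD) h2; have := v_above vD s.
move: (area n D) (tiles n D) => x y; lia.
Qed.

Lemma spread_tilingK n s l m (D : {set {set box n}}) : valid l m D ->
  contract_tiling s m (spread_tiling s m D) = D.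
Proof.
move=> vD; rewrite /contract_tiling.
have -> : spread_tiling s m D :\: ribbon n s m = [set spread s t | t in D].
  apply/setP => t; rewrite !inE; have [|] := boolP (t \in ribbon n s m) => /=.
    move=> tr; apply/esym/negP => /imsetP [t0 t0D e].
    by have := spread_ribbon_disjoint s vD t0D; rewrite -e tr.
  by rewrite orbF.
rewrite -imset_comp -[RHS]imset_id; apply: eq_in_imset => t _ /=.
exact: spreadK.
Qed.

Definition first_tight (n : nat) (m : seq bool) (D : {set {set box n}}) (s : nat) : bool :=
  [&& s.+1 < 2 * n, tight m D s.+1 & [forall x : 'I_s.+1, ~~ tight m D x]].

Lemma first_tightP n m (D : {set {set box n}}) s : reflect
  [/\ s.+1 < 2 * n, tight m D s.+1 & forall x, x <= s -> ~~ tight m D x]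
  (first_tight m D s).
Proof.
apply: (iffP and3P) => [[h1 h2 /forallP h3]|[h1 h2 h3]]; split => //.
  by move=> x xs; have := h3 (Ordinal (xs : x < s.+1)).
by apply/forallP => x; apply: h3; rewrite -ltnS.
Qed.

Lemma first_tight_unique n m (D : {set {set box n}}) s s' :
  first_tight m D s -> first_tight m D s' -> s = s'.
Proof.
move=> /first_tightP [_ t h] /first_tightP [_ t' h']; case: (ltngtP s s') => // lt.
  by have := h' _ lt; rewrite t.
by have := h _ lt; rewrite t'.
Qed.

Lemma first_tight_exists n l m (D : {set {set box n.+1}}) : valid l m D ->
  exists s : 'I_(2 * n.+1), first_tight m D s.
Proof.
move=> vD; have dm := v_dyck vD; have sm := v_size vD.
pose e := (2 * n).+1; have em : e < size m by rewrite sm /e; lia.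
have ex : exists x, (x < 2 * n.+1) && tight m D x.
  exists e; rewrite -sm em /tight; have := htS dm em.
  have ht1 : ht m e.+1 = 0 by rewrite ht_oversize // sm /e; lia.
  rewrite ht1; case: (nth _ _ _) => //= hte.
  apply/negP => tD; have := v_in vD tD; move/(_ e (ht m e).-1).
  rewrite boxin_top // ?eqxx; last by rewrite /e; lia.
  by move/(_ isT) => /and3P [_ h _]; move: h; rewrite hte.
case: (ex_minnP ex) => x /andP [xl tx] mn.
have x0 : 0 < x.
  case: x xl tx {mn} => // _; rewrite /tight dyck_nth0 //.
  by rewrite sm.
have x1 : x.-1 < 2 * n.+1 by lia.
exists (Ordinal x1); apply/first_tightP => /=; rewrite prednK //; split => //.
move=> y yx; apply/negP => ty; have := mn y; rewrite ty andbT; lia.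
Qed.

Lemma first_tight_spread n s l m (D : {set {set box n}}) : is_dyck l -> size l = 2 * n ->
  s <= 2 * n -> valid l m D -> first_tight (upins s m) (spread_tiling s m D) s.
Proof.
move=> dl sl sn vD; have dm := v_dyck vD; have sm := v_size vD.
have sm' : s <= size m by rewrite sm.
have [dum hm] := upins_dyck dm sm'.
have su : size (upins s m) = 2 * n.+1 by rewrite size_upins sm; lia.
apply/first_tightP; split; first by lia.
  rewrite /tight nth_upins // ltnn eqxx /=; apply/negP => /spread_tilingP.
  have s1 : s.+1 <= 2 * n.+1 by lia.
  case=> [[t tD e]|].
    have := boxin_top s.+1 (ht (upins s m) s.+1).-1 dum su s1.
    have := boxin_top s (ht (upins s m) s.+1).-1.-1 dum su s1.
    rewrite e !boxin_spread /spread_rel leqnn ltnn !eqxx /= => -> /andP [_].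
    by rewrite ltn_eqF.
  case/ribbonP => a [b [/and4P [_ as_ _ _] _ _ _ tE]].
  have := tE s.+1 (ht (upins s m) s.+1).-1; rewrite boxin_top // !eqxx.
  by move/esym/andP => [/eqP e _]; move: as_; rewrite -e ltnn.
move=> x xs; rewrite /tight negb_and !negbK.
have [//|nx] := boolP (nth false (upins s m) x).
rewrite /= inE; apply/orP; right; apply/(ribbon_topP _ dm sm sn).
by exists x.
Qed.

Definition path_tuple (n : nat) (m : seq bool) : n.-tuple bool :=
  insubd [tuple of nseq n false] m.

Lemma path_tupleK n m : size m = n -> path_tuple n m = m :> seq bool.
Proof. by move=> sm; rewrite val_insubd sm eqxx. Qed.

Definition validb (n : nat) (l : seq bool) (p : (2 * n).-tuple bool * {set {set box n}}) :=
  is_dyck p.1 && weakly_above n l p.1 && ci_dyck_tiling n l p.1 p.2.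

Lemma validbP n l (p : (2 * n).-tuple bool * {set {set box n}}) : is_dyck l -> size l = 2 * n ->
  reflect (valid l p.1 p.2) (@validb n l p).
Proof. by move=> dl sl; apply: (iffP idP) => /(validP _ dl sl (size_tuple p.1)). Qed.

Section TilingRecursion.

Local Open Scope ring_scope.

Lemma tiling_gfE n l : tiling_gf n l = \sum_(p | @validb n l p) 'X^(art n p.2).
Proof. by rewrite /tiling_gf pair_big_dep. Qed.

Lemma tiling_gf_rec n l : is_dyck l -> size l = (2 * n.+1)%N ->
  tiling_gf n.+1 l =
  \sum_(s : 'I_(2 * n.+1) | peak l s) 'X^(capacity l s) * tiling_gf n (del s l).
Proof.
move=> dl sl; rewrite tiling_gfE (big_exists_unique (K := fun s : 'I_(2 * n.+1) => peak l s)
  (R := fun (p : (2 * n.+1).-tuple bool * {set {set box n.+1}}) (s : 'I_(2 * n.+1)) =>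
    first_tight p.1 p.2 s)).
- apply: eq_bigr => s pl; rewrite tiling_gfE big_distrr /=.
  have s1 := peak_size pl.
  have dd := del_dyck dl pl.
  have sd : size (del s l) = (2 * n)%N by rewrite size_del //; lia.
  have sn : (s <= 2 * n)%N by lia.
  have Ed := delK pl; have Ec := capacity_peak dl pl.
  pose f (p : (2 * n.+1).-tuple bool * {set {set box n.+1}}) :=
    (path_tuple (2 * n) (updel s p.1), contract_tiling s (updel s p.1) p.2).
  pose g (p : (2 * n).-tuple bool * {set {set box n}}) :=
    (path_tuple (2 * n.+1) (upins s p.1), spread_tiling s p.1 p.2).
  apply: (big_bij_dep (f := f) (g := g)).
    case=> m D /= /andP [/(validbP _ dl sl) /= vD /first_tightP [h1 h2 h3]].
    have dm := v_dyck vD; have sm := v_size vD.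
    have sm1 : (s.+1 < size m)%N by rewrite sm.
    have nm : ~~ nth false m s.+1 by case/andP: h2.
    have m0 : nth false m 0 by apply: dyck_nth0; rewrite // (leq_trans _ sm1).
    have du : is_dyck (updel s m).
      by apply: updel_dyck => //; exact: (special_pos dl sl vD h1 h2 h3).
    have su : size (updel s m) = (2 * n)%N by rewrite size_updel // sm mulnS.
    have vD' := vD; rewrite -{1}Ed -{1}(updelK sm1 m0 nm) in vD'.
    have h2' := h2; rewrite -{1}(updelK sm1 m0 nm) in h2'.
    have h3' x : (x <= s)%N -> ~~ tight (upins s (updel s m)) D x.
      by rewrite updelK //; exact: h3.
    split.
      apply/validbP => //=; rewrite path_tupleK //.
      exact: contract_valid.
    rewrite /g /f /=; congr pair.
      by apply: val_inj; rewrite /= path_tupleK ?path_tupleK ?updelK // size_upins su; lia.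
    by rewrite path_tupleK //; exact: contract_tilingK dd sd sn du su vD' h2' h3'.
  case=> m D /= /(validbP _ dd sd) /= vD.
  have dm := v_dyck vD; have sm := v_size vD.
  have su : size (upins s m) = (2 * n.+1)%N by rewrite size_upins sm; lia.
  split.
  + rewrite path_tupleK // (first_tight_spread dd sd sn vD) andbT.
    by apply/validbP => //=; rewrite path_tupleK // -Ed; exact: spread_valid.
  + rewrite /f /g /=; congr pair.
      by apply: val_inj; rewrite /= path_tupleK // path_tupleK // upinsK // sm.
    by rewrite path_tupleK // upinsK ?sm //; exact: spread_tilingK vD.
  + by rewrite (art_spread dd sd sn vD) exprD Ec.
- by move=> p /(validbP _ dl sl) /first_tight_exists.
- by move=> p s s' _ h h'; apply: val_inj; exact: first_tight_unique h h'.
- move=> p s /(validbP _ dl sl) vD /first_tightP [h1 h2 h3].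
  exact: special_peak dl sl vD h1 h2 h3.
Qed.

Lemma P_LS0 l : size l = 0%N -> P_LS 0 l = 1.
Proof.
move=> /size0nil ->; rewrite /P_LS.
have E (nu nu' : {ffun 'I_(2 * 0) -> 'I_1}) : nu = nu' by apply/ffunP => -[].
rewrite (big_pred1 [ffun=> ord0]) => [|nu].
  by rewrite /sigma big1 ?expr0 // => -[].
rewrite (E nu [ffun=> ord0]) /= eqxx; apply/and3P.
by split; apply/forallP => -[].
Qed.

Lemma tiling_gf0 l : size l = 0%N -> tiling_gf 0 l = 1.
Proof.
move=> /size0nil ->; rewrite tiling_gfE.
have d0 : is_dyck [::] by apply/is_dyckP; split.
have h0 x : ht [::] x = 0%N by rewrite ht_oversize.
rewrite (big_pred1 ([tuple], set0)) => [|[m D]].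
  by rewrite /art /area /tiles /cover big_set0 !cards0 expr0.
rewrite (tuple0 m); apply/validbP/eqP => //= [vD|[->]].
  congr pair; apply/setP => t; rewrite inE; apply/negP => tD.
  have [i [j [h [ij Ht _ _ _]]]] := v_tile vD tD.
  have tb : boxin t i (h i) by rewrite Ht ij leqnn eqxx.
  by have := v_in vD tD tb; rewrite /inskew !h0; lia.
split=> //= [t|t|a b|t|t]; rewrite ?inE //.
by rewrite /inskew !h0; lia.
Qed.

End TilingRecursion.

Theorem mainTheorem1 (n : nat) (l : seq bool) :
  size l = (2 * n)%N -> is_dyck l -> tiling_gf n l = P_LS n l.
Proof.
elim: n l => [|n IHn] l sl dl; first by rewrite tiling_gf0 ?P_LS0.
rewrite tiling_gf_rec // P_LS_rec //; apply: eq_bigr => s pl.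
rewrite IHn ?del_dyck // size_del ?peak_size //; lia.
Qed.
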